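(* Let $X$ be a real normed space of finite dimension $N\geqslant 1$ with a 1-symmetric basis, regarded as $\mathbb{R}^N$ equipped with a norm $\|\cdot\|_X$ for which the canonical basis of $\mathbb{R}^N$ is 1-symmetric. Let $S_X=\{x\in\mathbb{R}^N\colon \|x\|_X=1\}$ be the unit sphere of $X$ and let $\mu$ be the normalised hypersurface measure on $S_X$. For $x\in S_X$, denote by $x^*$ the norming functional for $x$ in the case where it is unique, and let $D\subseteq S_X$ be the set of those $x\in S_X$ that have a unique norming functional. (i) The set $D$, on which the function $x\mapsto x^*$ is defined, satisfies $\mu(S_X\setminus D)=0$, and the function $x\mapsto x^*$ is continuous on $D$. (ii) If $A$ is a real $(N\times N)$-matrix, then $$\operatorname{tr} A = N\cdot \int_{S_X}\langle Ax, x^*\rangle\,\mu(\mathrm{d}x),$$ where the integral over $S_X$ is understood as the integral over $D$ (equivalently, $x\mapsto x^*$ is replaced by any measurable extension to a function from $S_X$ to the unit sphere $S_{X^*}$ of the dual space).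
   Context: A normalised basis $(x_n)_{n=1}^N$ of a finite-dimensional real normed space $X$ (so $\|x_n\|_X=1$ for all $n$) is called 1-symmetric if $\left\|\sum_{k=1}^N a_kx_k\right\|_X=\left\|\sum_{k=1}^N\varepsilon_k a_k x_{\sigma(k)}\right\|_X$ for all scalars $a_1,\ldots,a_N$, all $\varepsilon_1,\ldots,\varepsilon_N\in\{-1,1\}$ and every permutation $\sigma$ of $\{1,\ldots,N\}$. The space $X$ is identified with $\mathbb{R}^N$ so that the 1-symmetric basis is the canonical basis. The dual space $X^*$ is also identified, as a vector space, with $\mathbb{R}^N$ through the canonical inner product $\langle f,x\rangle=\sum_{j=1}^N f_jx_j$, i.e. $f\in X^*$ acts by $f(x)=\langle f,x\rangle$; $X^*$ carries the dual norm $\|f\|=\sup\{|\langle f,x\rangle|\colon \|x\|_X\leqslant 1\}$. For a non-zero $x\in X$, a norming functional for $x$ is an $f\in X^*$ with $\|f\|=1$ and $\langle f,x\rangle=\|x\|_X$. The hypersurface measure on $S_X$ is the $(N-1)$-dimensional surface measure (i.e. $(N-1)$-dimensional Hausdorff measure, completed) on $S_X\subset\mathbb{R}^N$ with respect to the canonical Euclidean structure of $\mathbb{R}^N$; normalised means rescaled to have total mass $1$. *)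

(* Defs.v *)
From HB Require Import structures.
From mathcomp Require Import all_boot all_order all_algebra all_fingroup.
From mathcomp Require Import all_classical all_reals all_analysis.

Set Implicit Arguments.
Unset Strict Implicit.
Unset Printing Implicit Defensive.

Import Order.TTheory GRing.Theory Num.Theory.
Import numFieldNormedType.Exports.

Local Open Scope classical_set_scope.
Local Open Scope ring_scope.

(* Vectors of R^N are the columns 'cV[R]_N.  The library topology on this type
   is the product topology, i.e. the one given by any norm on R^N, which is
   therefore both the topology of X and that of its dual.  The norm of X is an
   arbitrary function p on columns satisfying is_norm; it is unrelated to the
   library norm `| _ | on matrices. *)

Definition is_norm (R : realType) (N : nat) (p : 'cV[R]_N -> R) : Prop :=
  [/\ forall x y, p (x + y) <= p x + p y,
      forall (a : R) x, p (a *: x) = `|a| * p x &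
      forall x, p x = 0 -> x = 0].

Definition canonical_basis (R : realType) (N : nat) (k : 'I_N) : 'cV[R]_N :=
  delta_mx k 0.

Definition one_symmetric (R : realType) (N : nat) (p : 'cV[R]_N -> R)
    (b : 'I_N -> 'cV[R]_N) : Prop :=
  (forall k, p (b k) = 1) /\
  (forall (a eps : 'I_N -> R) (sigma : {perm 'I_N}),
     (forall k, eps k = -1 \/ eps k = 1) ->
     p (\sum_k a k *: b k) = p (\sum_k (eps k * a k) *: b (sigma k))).

Definition dotp (R : realType) (N : nat) (f x : 'cV[R]_N) : R :=
  \sum_j f j 0 * x j 0.

Definition unit_sphere (R : realType) (N : nat) (p : 'cV[R]_N -> R) :
    set 'cV[R]_N :=
  [set x | p x = 1].

Definition dual_norm (R : realType) (N : nat) (p : 'cV[R]_N -> R)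
    (f : 'cV[R]_N) : R :=
  sup [set `|dotp f x| | x in [set x | p x <= 1]].

Definition norming (R : realType) (N : nat) (p : 'cV[R]_N -> R)
    (x f : 'cV[R]_N) : Prop :=
  dual_norm p f = 1 /\ dotp f x = p x.

Definition smooth_points (R : realType) (N : nat) (p : 'cV[R]_N -> R) :
    set 'cV[R]_N :=
  [set x | unit_sphere p x /\ exists! f, norming p x f].

(* The map x |-> x^*.  Only its values on smooth_points p are meaningful. *)
Definition star (R : realType) (N : nat) (p : 'cV[R]_N -> R)
    (x : 'cV[R]_N) : 'cV[R]_N :=
  xget 0 [set f | norming p x f].

Definition euclidean_norm (R : realType) (N : nat) (x : 'cV[R]_N) : R :=
  Num.sqrt (dotp x x).

Local Open Scope ereal_scope.

Definition diameter (R : realType) (N : nat) (A : set 'cV[R]_N) : \bar R :=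
  ereal_sup [set (euclidean_norm (x - y))%:E | x in A & y in A].

(* For s = 0 a nonempty set has gauge 1 and the empty set has gauge 0, so that
   the 0-dimensional Hausdorff measure is the counting measure. *)
Definition hausdorff_gauge (R : realType) (N s : nat) (A : set 'cV[R]_N) :
    \bar R :=
  if A == set0 then 0 else diameter A ^+ s.

Definition hausdorff_cover (R : realType) (N : nat) (delta : R)
    (A : set 'cV[R]_N) : set ((set 'cV[R]_N)^nat) :=
  [set U | (forall k, diameter (U k) <= delta%:E) /\ A `<=` \bigcup_k U k].

Definition hausdorff_content (R : realType) (N s : nat) (delta : R)
    (A : set 'cV[R]_N) : \bar R :=
  ereal_inf [set \sum_(k <oo) hausdorff_gauge s (U k)
            | U in hausdorff_cover delta A].

(* The s-dimensional Hausdorff outer measure for the Euclidean metric, without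
   the dimensional constant that makes it agree with Lebesgue measure: the
   constant cancels in the normalisation of surface_outer below. *)
Definition hausdorff (R : realType) (N s : nat) (A : set 'cV[R]_N) : \bar R :=
  ereal_sup [set hausdorff_content s delta A | delta in [set d : R | (0 < d)%R]].

(* Outer measure on R^N concentrated on the sphere.  Its restriction to the
   Caratheodory measurable sets is the completion of the normalised Borel
   surface measure. *)
Definition surface_outer (R : realType) (N : nat) (p : 'cV[R]_N -> R)
    (A : set 'cV[R]_N) : \bar R :=
  ((fine (hausdorff N.-1 (unit_sphere p)))^-1)%:E *
  hausdorff N.-1 (A `&` unit_sphere p).

Lemma euclidean_norm_ge0 (R : realType) (N : nat) (x : 'cV[R]_N) :
  (0 <= euclidean_norm x)%R.
Proof. exact: sqrtr_ge0. Qed.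

Lemma diameter_ge0 (R : realType) (N : nat) (A : set 'cV[R]_N) :
  A !=set0 -> 0 <= diameter A.
Proof.
move=> [x Ax]; apply: (@le_trans _ _ (euclidean_norm (x - x))%:E).
  by rewrite lee_fin euclidean_norm_ge0.
by apply: ereal_sup_ubound; exists x => //; exists x.
Qed.

Lemma hausdorff_gauge_ge0 (R : realType) (N s : nat) (A : set 'cV[R]_N) :
  0 <= hausdorff_gauge s A.
Proof.
rewrite /hausdorff_gauge; case: ifPn => // /set0P A0.
by apply: expe_ge0; exact: diameter_ge0.
Qed.

Lemma hausdorff_gauge0 (R : realType) (N s : nat) :
  hausdorff_gauge s (set0 : set 'cV[R]_N) = 0.
Proof. by rewrite /hausdorff_gauge eqxx. Qed.

Lemma diameter_set0 (R : realType) (N : nat) :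
  diameter (set0 : set 'cV[R]_N) = -oo.
Proof.
rewrite /diameter; set S := (X in ereal_sup X).
suff -> : S = set0 by rewrite ereal_sup0.
by rewrite -subset0 => y [x].
Qed.

Lemma hausdorff_content_ge0 (R : realType) (N s : nat) (delta : R)
  (A : set 'cV[R]_N) : 0 <= hausdorff_content s delta A.
Proof.
apply: le_ereal_inf_tmp => _ [U _ <-]; apply: nneseries_ge0 => k _ _.
exact: hausdorff_gauge_ge0.
Qed.

Lemma hausdorff_content0 (R : realType) (N s : nat) (delta : R) :
  hausdorff_content s delta (set0 : set 'cV[R]_N) = 0.
Proof.
apply/eqP; rewrite eq_le hausdorff_content_ge0 andbT.
apply: ereal_inf_lbound; exists (fun=> set0).
  by split=> [k|x //]; rewrite diameter_set0 leNye.
by apply: eseries0 => k _ _; exact: hausdorff_gauge0.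
Qed.

Lemma le_hausdorff_content (R : realType) (N s : nat) (delta : R) :
  {homo (@hausdorff_content R N s delta) : A B / A `<=` B >-> A <= B}.
Proof.
move=> A B AB; apply: ereal_inf_le_tmp => _ [U [dU BU] <-].
by exists U => //; split => //; exact: subset_trans BU.
Qed.

Lemma hausdorff_content_sigma_subadditive (R : realType) (N s : nat)
  (delta : R) : sigma_subadditive (@hausdorff_content R N s delta).
Proof.
move=> A; have [[i ioo]|] :=
    pselect (exists i, hausdorff_content s delta (A i) = +oo).
  rewrite (eseries_pinfty _ _ ioo) ?leey// => n _.
  by rewrite -ltNye (lt_le_trans _ (hausdorff_content_ge0 _ _ _)).
rewrite -forallNE => Aoo.
suff add2e (e : {posnum R}) : hausdorff_content s delta (\bigcup_n A n) <=
    \sum_(i <oo) hausdorff_content s delta (A i) + e%:num%:E.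
  by apply/lee_addgt0Pr => _/posnumP[].
rewrite (le_trans _ (epsilon_trick _ _ _))//; last first.
  by move=> n; exact: hausdorff_content_ge0.
pose P n (B : (set 'cV[R]_N)^nat) := hausdorff_cover delta (A n) B /\
  \sum_(k <oo) hausdorff_gauge s (B k) <=
  hausdorff_content s delta (A n) + (e%:num / (2 ^ n.+1)%:R)%:E.
have [G PG] : {G : ((set 'cV[R]_N)^nat)^nat & forall n, P n (G n)}.
  apply: (@choice _ _ P) => n; rewrite /P /hausdorff_content.
  set S := (X in ereal_inf X); move infS : (ereal_inf S) => iS.
  case: iS infS => [r Sr|Soo|Soo].
  - have en1 : (0 < e%:num / (2 ^ n.+1)%:R)%R by [].
    have /(lb_ereal_inf_adherent en1) : ereal_inf S \is a fin_num by rewrite Sr.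
    move=> [x [B AnB muBx] xS].
    by exists B; split => //; rewrite muBx -Sr; exact/ltW.
  - by have := Aoo n; rewrite /hausdorff_content Soo.
  - suff : lbound S 0 by move/le_ereal_inf_tmp; rewrite Soo.
    move=> /= _ [B _ <-]; apply: nneseries_ge0 => k _ _.
    exact: hausdorff_gauge_ge0.
pose g := @hausdorff_gauge R N s.
have g_ge0 B : 0 <= g B by exact: hausdorff_gauge_ge0.
have muG_ge0 x : 0 <= (g \o uncurry G) x by exact: g_ge0.
apply: (@le_trans _ _ (\esum_(i in setT) (g \o uncurry G) i)).
  apply: ereal_inf_lbound => /=.
  have /card_esym/ppcard_eqP[f] := card_nat2.
  exists (uncurry G \o f).
    split => [k|] /=; first by case: (f k) => i j; exact: (PG i).1.1.
    apply: (@subset_trans _  (\bigcup_n \bigcup_k G n k)) => [t [i _]|].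
      by move=> /((PG i).1.2) -[j _ ?]; exists i => //; exists j.
    move=> t [i _ [j _ Bijt]]; exists (f^-1%FUN (i, j)) => //=.
    by rewrite invK ?inE.
  rewrite -(esum_pred_image (g \o uncurry G) _ xpredT) ?[fun=> _]set_true//.
  by rewrite image_eq.
rewrite (_ : esum _ _ = \sum_(i <oo) \sum_(j <oo) g (G i j)); last first.
  pose J : nat -> set (nat * nat) := fun i => [set (i, j) | j in setT].
  rewrite (_ : setT = \bigcup_k J k); last first.
    by rewrite predeqE => -[a b]; split => // _; exists a => //; exists b.
  rewrite esum_bigcupT /=; last 2 first.
    - apply/trivIsetP => i j _ _ ij.
      rewrite predeqE => -[n m] /=; split => //= -[] [_] _ [<-{n} _].
      by move=> [m' _] [] /esym/eqP; rewrite (negbTE ij).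
    - by move=> /= [n m]; exact: g_ge0.
  rewrite -(image_id [set: nat]) -fun_true esum_pred_image//; last first.
    by move=> n _; exact: esum_ge0.
  apply: eq_eseriesr => /= j _.
  rewrite -(esum_pred_image (g \o uncurry G) (pair j) predT)//=; last first.
    by move=> ? ? _ _; exact: (@can_inj _ _ _ snd).
  by congr esum; rewrite predeqE => -[a b]; split; move=> [i _ <-]; exists i.
apply: lee_nneseries => [n _ _|n _]; last exact: (PG n).2.
by apply: nneseries_ge0 => m _ _; exact: g_ge0.
Qed.

Lemma hausdorff_content_le (R : realType) (N s : nat) (delta : R)
  (A : set 'cV[R]_N) : (0 < delta)%R ->
  hausdorff_content s delta A <= hausdorff s A.
Proof. by move=> d0; apply: ereal_sup_ubound; exists delta. Qed.

Lemma hausdorff_ge0 (R : realType) (N s : nat) (A : set 'cV[R]_N) :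
  0 <= hausdorff s A.
Proof.
exact: le_trans (hausdorff_content_ge0 s 1 A) (hausdorff_content_le _ _ _).
Qed.

Lemma hausdorff0 (R : realType) (N s : nat) :
  hausdorff s (set0 : set 'cV[R]_N) = 0.
Proof.
apply/eqP; rewrite eq_le hausdorff_ge0 andbT.
by apply: ge_ereal_sup => _ [d _ <-]; rewrite hausdorff_content0.
Qed.

Lemma le_hausdorff (R : realType) (N s : nat) :
  {homo (@hausdorff R N s) : A B / A `<=` B >-> A <= B}.
Proof.
move=> A B AB; apply: ge_ereal_sup => _ [d d0 <-].
by rewrite (le_trans (le_hausdorff_content _ _ AB))// hausdorff_content_le.
Qed.

Lemma hausdorff_sigma_subadditive (R : realType) (N s : nat) :
  sigma_subadditive (@hausdorff R N s).
Proof.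
move=> A; apply: ge_ereal_sup => _ [d d0 <-].
rewrite (le_trans (hausdorff_content_sigma_subadditive s d A))//.
apply: lee_nneseries => k _; first by move=> _; exact: hausdorff_content_ge0.
exact: hausdorff_content_le.
Qed.

HB.instance Definition _ (R : realType) (N s : nat) :=
  isOuterMeasure.Build R 'cV[R]_N (@hausdorff R N s)
    (@hausdorff0 R N s) (@hausdorff_ge0 R N s) (@le_hausdorff R N s)
    (@hausdorff_sigma_subadditive R N s).

Lemma surface_factor_ge0 (R : realType) (N : nat) (p : 'cV[R]_N -> R) :
  (0 <= (fine (hausdorff N.-1 (unit_sphere p)))^-1)%R.
Proof. by rewrite invr_ge0 fine_ge0// hausdorff_ge0. Qed.

Lemma surface_outer0 (R : realType) (N : nat) (p : 'cV[R]_N -> R) :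
  surface_outer p set0 = 0.
Proof. by rewrite /surface_outer set0I hausdorff0 mule0. Qed.

Lemma surface_outer_ge0 (R : realType) (N : nat) (p : 'cV[R]_N -> R)
  (A : set 'cV[R]_N) : 0 <= surface_outer p A.
Proof.
by rewrite mule_ge0 ?hausdorff_ge0// lee_fin surface_factor_ge0.
Qed.

Lemma le_surface_outer (R : realType) (N : nat) (p : 'cV[R]_N -> R) :
  {homo (surface_outer p) : A B / A `<=` B >-> A <= B}.
Proof.
move=> A B AB; apply: lee_wpmul2l; first by rewrite lee_fin surface_factor_ge0.
by apply: le_hausdorff; exact: setSI.
Qed.

Lemma surface_outer_sigma_subadditive (R : realType) (N : nat)
  (p : 'cV[R]_N -> R) : sigma_subadditive (surface_outer p).
Proof.
move=> A; rewrite /surface_outer setI_bigcupl nneseriesZl; last first.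
  by move=> k _; exact: hausdorff_ge0.
apply: lee_wpmul2l; first by rewrite lee_fin surface_factor_ge0.
exact: hausdorff_sigma_subadditive.
Qed.

HB.instance Definition _ (R : realType) (N : nat) (p : 'cV[R]_N -> R) :=
  isOuterMeasure.Build R 'cV[R]_N (surface_outer p)
    (surface_outer0 p) (@surface_outer_ge0 R N p) (@le_surface_outer R N p)
    (@surface_outer_sigma_subadditive R N p).

Definition surface_measure (R : realType) (N : nat) (p : 'cV[R]_N -> R) :
    {measure set (caratheodory_type (surface_outer p)) -> \bar R} :=
  (surface_outer p : {outer_measure set 'cV[R]_N -> \bar R}) :
    set (caratheodory_type (surface_outer p)) -> \bar R.

(* Main.v *)
Require Import Defs.
From HB Require Import structures.
From mathcomp Require Import all_boot all_order all_algebra all_fingroup.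
From mathcomp Require Import all_classical all_reals all_analysis.
From mathcomp Require Import measurable_realfun zify ring lra.

Set Implicit Arguments.
Unset Strict Implicit.
Unset Printing Implicit Defensive.

Import Order.TTheory GRing.Theory Num.Theory.
Import numFieldNormedType.Exports.
Local Open Scope classical_set_scope.
Local Open Scope ring_scope.

(** Signed permutations of the coordinates preserve both the norm and the
    Euclidean distance, hence the unit sphere S, its smooth points and the
    surface measure mu, and they commute with x |-> x*.
    Let m(i, j) be the mean of x_j x*_i over the smooth points.  Flipping the
    sign of the i-th coordinate gives m(i, j) = - m(i, j) for i <> j, swapping
    the i-th and the j-th one gives m(i, i) = m(j, j), and the sum of the
    m(i, i) is the mean of <x*, x> = 1.  So m(i, j) is 1/N on the diagonal and 0
    off it, and the integral of <Ax, x*>, the sum of the A_ij m(i, j), is the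
    trace of A divided by N (trace_formula).

    This needs 0 < H(S) < +oo for the Hausdorff measure H of dimension N-1,
    since the normalising constant would otherwise be zero; that mu neglects
    the non-smooth points; and that the coordinates of x and x* are
    measurable.

    - Finiteness: radial projection onto the faces of the cube is Lipschitz in
      both directions, and a face is cut into n^(N-1) cells of size 1/n
      (hausdorff_lipschitz_fin, hausdorff_sphere_lt_pinfty).

    - Positivity: any cover of S induces a cover of a face by boxes, and boxes
      covering the unit cube have total volume at least 1 (box_cover); this is
      proved one coordinate at a time with the Lebesgue measure of the line.

    - Non-smooth points: if f and g norm x and f_k < g_k, put rationals
      f_k <= r < s <= g_k between them.  The points with such a pair form a cone
      (kink), and by monotonicity of the subdifferential their k-th coordinate
      is a Lipschitz function of the others (kink_lipschitz).  The trace of the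
      cone on S is therefore described by N-2 parameters and is H-null
      (kink_null); countably many such sets cover the non-smooth points.

    - Sublevel sets of Lipschitz functions are measurable by the criterion of
      Caratheodory for metric outer measures (hausdorff_caratheodory).

    - At a smooth point <x*, v> is the one-sided derivative of the norm in the
      direction v (star_dirderiv), an infimum of continuous functions of x.
      Hence it is upper semicontinuous; the directions v and -v together give
      continuity, and difference quotients give measurability.

    Norming functionals with a prescribed value in one direction come from a
    finite-dimensional Hahn-Banach theorem: replacing a sublinear function by
    its derivative at w makes it linear along w, and doing so along every basis
    vector makes it linear (hahn_banach). *)

(** * Dot product and Euclidean norm *)

Section DotProduct.
Variables (R : realType) (N : nat).
Implicit Types (x y f g : 'cV[R]_N) (a : R).

Lemma dotpDr f x y : dotp f (x + y) = dotp f x + dotp f y.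
Proof.
by rewrite /dotp -big_split; apply: eq_bigr => j _; rewrite mxE mulrDr.
Qed.

Lemma dotpZr f a x : dotp f (a *: x) = a * dotp f x.
Proof.
by rewrite /dotp mulr_sumr; apply: eq_bigr => j _; rewrite mxE mulrCA.
Qed.

Lemma dotpNr f x : dotp f (- x) = - dotp f x.
Proof. by rewrite -scaleN1r dotpZr mulN1r. Qed.

Lemma dotpBr f x y : dotp f (x - y) = dotp f x - dotp f y.
Proof. by rewrite dotpDr dotpNr. Qed.

Lemma dotp_basis f k : dotp f (canonical_basis R k) = f k 0.
Proof.
rewrite /dotp (bigD1 k)//= big1 ?addr0; last first.
  by move=> j jk; rewrite mxE (negbTE jk) mulr0.
by rewrite mxE !eqxx mulr1.
Qed.

Lemma sum_canonical_basis x : x = \sum_k x k 0 *: canonical_basis R k.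
Proof.
apply/matrixP => i j; rewrite [j]ord1 summxE (bigD1 i)//= big1 ?addr0.
  by rewrite !mxE !eqxx mulr1.
by move=> k ki; rewrite !mxE eq_sym (negbTE ki) mulr0.
Qed.

Lemma ler_coord_euclidean x j : `|x j 0| <= euclidean_norm x.
Proof.
rewrite /euclidean_norm -sqrtr_sqr ler_wsqrtr// /dotp (bigD1 j)//= -expr2.
by rewrite lerDl sumr_ge0// => i _; rewrite -expr2 sqr_ge0.
Qed.

Lemma euclidean_le_sum x : euclidean_norm x <= \sum_j `|x j 0|.
Proof.
have s0 : 0 <= \sum_j `|x j 0| by rewrite sumr_ge0.
rewrite -(ger0_norm s0) -sqrtr_sqr /euclidean_norm ler_wsqrtr//.
rewrite expr2 mulr_suml /dotp ler_sum// => j _.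
rewrite mulr_sumr (bigD1 j)//= -normrM ger0_norm -?expr2 ?sqr_ge0//.
by rewrite lerDl sumr_ge0// => i _; rewrite mulr_ge0.
Qed.

Lemma sum_le_euclidean x : \sum_j `|x j 0| <= N%:R * euclidean_norm x.
Proof.
apply: (@le_trans _ _ (\sum_(j < N) euclidean_norm x)).
  by apply: ler_sum => j _; exact: ler_coord_euclidean.
by rewrite sumr_const card_ord mulr_natl.
Qed.

Lemma euclidean_normZ a x : euclidean_norm (a *: x) = `|a| * euclidean_norm x.
Proof.
rewrite /euclidean_norm -sqrtr_sqr -sqrtrM ?sqr_ge0// dotpZr /dotp expr2 -mulrA.
suff -> : \sum_j (a *: x) j 0 * x j 0 = a * \sum_j x j 0 * x j 0 by [].
by rewrite mulr_sumr; apply: eq_bigr => j _; rewrite mxE mulrA.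
Qed.

End DotProduct.

(** * Sublinear functions and one-sided derivatives *)

Section Sublinear.
Variables (R : realType) (N : nat).
Implicit Types (q : 'cV[R]_N -> R) (u v w x y : 'cV[R]_N).

Definition sublinear q : Prop :=
  (forall x y, q (x + y) <= q x + q y) /\
  (forall a x, 0 <= a -> q (a *: x) = a * q x).

Definition linear_along q v : Prop := q (- v) = - q v.

(** The one-sided derivative of q at w in the direction v: with h = 1/t the
    quotient (q (w + h v) - q w) / h is q (v + t w) - t q w, which decreases
    with t.  This form needs no division and is meaningful at w = 0. *)
Definition dirderiv q w v : R :=
  inf [set q (v + t *: w) - t * q w | t in [set t : R | 0 <= t]].

Lemma sublinear0 q : sublinear q -> q 0 = 0.
Proof. by move=> [_ qZ]; rewrite -(scale0r 0) qZ// mul0r. Qed.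

Lemma sublinearN q v : sublinear q -> - q (- v) <= q v.
Proof.
move=> qs; rewrite -subr_ge0 opprK -(sublinear0 qs) -(subrr v).
exact: qs.1.
Qed.

Lemma sublinearB q v w : sublinear q -> q v - q w <= q (v - w).
Proof. by move=> qs; rewrite lerBlDr -{1}(subrK w v); exact: qs.1. Qed.

Lemma dirderiv_has_inf q w v : sublinear q ->
  has_inf [set q (v + t *: w) - t * q w | t in [set t : R | 0 <= t]].
Proof.
move=> qs; split; first by exists (q (v + 0 *: w) - 0 * q w), 0 => //=.
exists (- q (- v)) => _ [t /= t0 <-].
rewrite lerBrDl lerBlDl -qs.2// -[X in q X](addKr v (t *: w)).
exact: qs.1.
Qed.

Lemma dirderiv_le q w v t : sublinear q -> 0 <= t ->
  dirderiv q w v <= q (v + t *: w) - t * q w.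
Proof.
by move=> qs t0; apply: ge_inf; [exact: (dirderiv_has_inf _ _ qs).2|exists t].
Qed.

Lemma dirderiv_lt q w v b : sublinear q -> dirderiv q w v < b ->
  exists2 t, 0 <= t & q (v + t *: w) - t * q w < b.
Proof.
move=> qs; rewrite -subr_gt0 => h.
have [_ [t /= t0 <-] qb] := inf_adherent h (dirderiv_has_inf w v qs).
by exists t => //; apply: lt_le_trans qb _; rewrite addrC subrK.
Qed.

Lemma dirderiv_ge q w v b : sublinear q ->
  (forall t, 0 <= t -> b <= q (v + t *: w) - t * q w) -> b <= dirderiv q w v.
Proof.
move=> qs h; apply: lb_le_inf; first exact: (dirderiv_has_inf _ _ qs).1.
by move=> _ [t /= t0 <-]; exact: h.
Qed.

Lemma dirderiv_leq q w v : sublinear q -> dirderiv q w v <= q v.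
Proof.
by move=> qs; rewrite (le_trans (dirderiv_le w v qs (lexx 0)))//
  scale0r addr0 mul0r subr0.
Qed.

Lemma dirquot_anti q w v s t : sublinear q -> 0 <= s <= t ->
  q (v + t *: w) - t * q w <= q (v + s *: w) - s * q w.
Proof.
move=> qs /andP[s0 st].
have -> : v + t *: w = (v + s *: w) + (t - s) *: w.
  by rewrite -addrA -scalerDl addrCA subrr addr0.
have := qs.1 (v + s *: w) ((t - s) *: w); rewrite qs.2 ?subr_ge0//; lra.
Qed.

Lemma dirderiv_sublinear q w : sublinear q -> sublinear (dirderiv q w).
Proof.
move=> qs; split=> [x y|a x a0].
  apply/ler_addgt0Pr => e e0.
  have e2 : 0 < e / 2 by rewrite divr_gt0.
  have [s s0 xs] := dirderiv_lt qs (ltr_pwDr e2 (lexx (dirderiv q w x))).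
  have [t t0 yt] := dirderiv_lt qs (ltr_pwDr e2 (lexx (dirderiv q w y))).
  have := dirderiv_le w (x + y) qs (addr_ge0 s0 t0).
  have -> : x + y + (s + t) *: w = (x + s *: w) + (y + t *: w).
    by rewrite scalerDl addrACA.
  have := qs.1 (x + s *: w) (y + t *: w); lra.
have [->|an0] := eqVneq a 0.
  rewrite scale0r mul0r; apply/eqP; rewrite eq_le; apply/andP; split.
    by rewrite -(sublinear0 qs) dirderiv_leq.
  by apply: dirderiv_ge => // t t0; rewrite add0r qs.2// subrr.
have {an0}a0 : 0 < a by rewrite lt_neqAle eq_sym an0.
have aq t : q (a *: x + t *: w) = a * q (x + (t / a) *: w).
  by rewrite -qs.2 ?ltW// scalerDr scalerA mulrCA mulfV ?gt_eqF// mulr1.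
apply/eqP; rewrite eq_le; apply/andP; split.
  rewrite mulrC -ler_pdivrMr//; apply: dirderiv_ge => // t t0.
  rewrite ler_pdivrMr//.
  have := dirderiv_le w (a *: x) qs (mulr_ge0 (ltW a0) t0).
  rewrite aq mulrAC mulfV ?gt_eqF// mul1r; lra.
apply: dirderiv_ge => // t t0; rewrite aq.
have := dirderiv_le w x qs (divr_ge0 t0 (ltW a0)).
rewrite -(ler_pM2l a0) => /le_trans; apply.
by rewrite mulrBr mulrA (mulrCA a) mulfV ?gt_eqF// mulr1.
Qed.

Lemma dirderiv_along q w v : sublinear q -> linear_along q v ->
  dirderiv q w v = q v /\ linear_along (dirderiv q w) v.
Proof.
move=> qs qv; have ds := dirderiv_sublinear w qs.
have h1 := dirderiv_leq w v qs; have h2 := dirderiv_leq w (- v) qs.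
have h3 := sublinearN v ds; rewrite /linear_along in qv *.
by split; lra.
Qed.

Lemma dirderiv_self q w : sublinear q -> linear_along (dirderiv q w) w /\
  dirderiv q w w = q w.
Proof.
move=> qs; have ds := dirderiv_sublinear w qs.
have h1 := dirderiv_leq w w qs.
have h2 := dirderiv_le w (- w) qs ler01; rewrite scale1r addNr in h2.
have h3 := sublinearN w ds; have h4 := sublinear0 qs.
rewrite /linear_along; split; lra.
Qed.

(** Writing f_k for q (e_k), subadditivity and linearity along each e_k give
    q <= <f, _>; applied to - x this is the reverse inequality. *)
Lemma sublinear_dotp q : sublinear q ->
  (forall k, linear_along q (canonical_basis R k)) ->
  exists f : 'cV[R]_N, forall x, q x = dotp f x.
Proof.
move=> qs ql; exists (\col_k q (canonical_basis R k)) => x.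
have qle y : q y <= dotp (\col_k q (canonical_basis R k)) y.
  rewrite {1}[y]sum_canonical_basis /dotp.
  elim/big_ind2 : _ => [|a a' b b' ha hb|k _]; first by rewrite (sublinear0 qs).
    by rewrite (le_trans (qs.1 _ _))// lerD.
  rewrite mxE; have [y0|y0] := leP 0 (y k 0); first by rewrite qs.2// mulrC.
  rewrite -[y k 0]opprK scaleNr -scalerN qs.2 ?oppr_ge0 ?(ltW y0)//.
  by rewrite ql mulrNN opprK mulrC.
apply/eqP; rewrite eq_le qle/=.
by have := qle (- x); rewrite dotpNr; have := sublinearN x qs; lra.
Qed.

(** Differentiating at v first fixes the value q v and linearity along v; the
    later derivatives, at the basis vectors, are smaller sublinear functions
    that keep every linearity already obtained. *)
Lemma hahn_banach q v : sublinear q ->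
  exists f : 'cV[R]_N, (forall x, dotp f x <= q x) /\ dotp f v = q v.
Proof.
move=> qs.
suff [r [rs rq rv rl]] : exists r, [/\ sublinear r, forall x, r x <= q x,
    r v = q v & forall k, linear_along r (canonical_basis R k)].
  by have [f fE] := sublinear_dotp rs rl; exists f; split=> [x|]; rewrite -fE.
suff : forall s : seq 'I_N, exists r, [/\ sublinear r, forall x, r x <= q x,
    r v = q v /\ linear_along r v &
    forall k, k \in s -> linear_along r (canonical_basis R k)].
  move=> /(_ (enum 'I_N))[r [rs rq [rv _] rl]]; exists r; split => // k.
  by apply: rl; rewrite mem_enum.
elim=> [|k s [r [rs rq [rv rlv] rl]]].
  have [dl dv] := dirderiv_self v qs.
  exists (dirderiv q v); split=> //; first exact: dirderiv_sublinear.
  by move=> x; exact: dirderiv_leq.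
have [dv dl] := dirderiv_along (canonical_basis R k) rs rlv.
exists (dirderiv r (canonical_basis R k)); split.
- exact: dirderiv_sublinear.
- by move=> x; exact: le_trans (dirderiv_leq _ _ rs) _.
- by rewrite dv.
- move=> j; rewrite inE => /predU1P[->|js].
    by have [] := dirderiv_self (canonical_basis R k) rs.
  by have [] := dirderiv_along (canonical_basis R k) rs (rl _ js).
Qed.

End Sublinear.

(** * Signed permutations of the coordinates *)

Section SignedPermutation.
Variables (R : realType) (N : nat).
Implicit Types (x y f g : 'cV[R]_N) (eps : 'I_N -> R) (s : {perm 'I_N}).

Definition signed_perm eps s x : 'cV[R]_N := \col_j (eps j * x (s j) 0).

Definition signs eps : Prop := forall k, eps k = -1 \/ eps k = 1.

Lemma signs_sqr eps k : signs eps -> eps k * eps k = 1.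
Proof. by move=> /(_ k)[] ->; rewrite ?mulrNN mulr1. Qed.

Lemma signed_permB eps s x y :
  signed_perm eps s (x - y) = signed_perm eps s x - signed_perm eps s y.
Proof. by apply/colP => j; rewrite !mxE mulrBr. Qed.

Lemma dotp_signed_perm eps s f x : signs eps ->
  dotp (signed_perm eps s f) (signed_perm eps s x) = dotp f x.
Proof.
move=> e1; rewrite /dotp [RHS](reindex_inj (@perm_inj _ s))/=.
by apply: eq_bigr => j _; rewrite !mxE mulrACA signs_sqr// mul1r.
Qed.

Lemma euclidean_signed_perm eps s x : signs eps ->
  euclidean_norm (signed_perm eps s x) = euclidean_norm x.
Proof. by move=> e1; rewrite /euclidean_norm dotp_signed_perm. Qed.

Definition signed_perm_inv eps s : 'cV[R]_N -> 'cV[R]_N :=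
  signed_perm (eps \o s^-1%g) s^-1%g.

Lemma signs_inv eps s : signs eps -> signs (eps \o s^-1%g).
Proof. by move=> e1 k; exact: e1. Qed.

Lemma signed_permK eps s : signs eps ->
  cancel (signed_perm eps s) (signed_perm_inv eps s).
Proof.
by move=> e1 x; apply/colP => j; rewrite !mxE/= permKV mulrA signs_sqr// mul1r.
Qed.

Lemma signed_permVK eps s : signs eps ->
  cancel (signed_perm_inv eps s) (signed_perm eps s).
Proof.
by move=> e1 x; apply/colP => j; rewrite !mxE/= permK mulrA signs_sqr// mul1r.
Qed.

End SignedPermutation.

(** * Norming functionals of a symmetric norm *)

Section SymmetricNorm.
Variables (R : realType) (N : nat) (p : 'cV[R]_N -> R).
Hypothesis p_norm : is_norm p.
Hypothesis p_sym : one_symmetric p (@canonical_basis R N).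
Implicit Types (x y f g v : 'cV[R]_N) (k : 'I_N).

Lemma norm_sublinear : sublinear p.
Proof.
by case: p_norm => pD pZ _; split=> // a x a0; rewrite pZ ger0_norm.
Qed.

Lemma is_norm0 : p 0 = 0.
Proof. exact: sublinear0 norm_sublinear. Qed.

Lemma is_normN x : p (- x) = p x.
Proof. by case: p_norm => _ pZ _; rewrite -scaleN1r pZ normrN1 mul1r. Qed.

Lemma is_norm_ge0 x : 0 <= p x.
Proof. by have := sublinearN x norm_sublinear; rewrite is_normN; lra. Qed.

Lemma is_norm_gt0 x : x != 0 -> 0 < p x.
Proof.
move=> x0; rewrite lt_neqAle is_norm_ge0 andbT eq_sym; apply: contra_neq x0.
by case: p_norm => _ _; exact.
Qed.

Lemma one_symmetric_basis k : p (canonical_basis R k) = 1.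
Proof. by case: p_sym => h _; exact: h. Qed.

Lemma one_symmetric_signed_perm eps s x : signs eps ->
  p (signed_perm eps s x) = p x.
Proof.
move=> e1; case: p_sym => _ /(_ (fun k => x k 0) (eps \o s^-1%g) s^-1%g).
rewrite -sum_canonical_basis => ->; last by move=> k; exact: e1.
congr p; rewrite [LHS]sum_canonical_basis (reindex_inj (@perm_inj _ s^-1%g)).
by apply: eq_bigr => k _; rewrite mxE permKV.
Qed.

(** If x' is x with its k-th sign flipped, then x - x' = 2 x_k e_k, while x and
    x' have the same norm. *)
Lemma coord_le_norm x k : `|x k 0| <= p x.
Proof.
pose eps j : R := if j == k then -1 else 1.
have e1 : signs eps by move=> j; rewrite /eps; case: ifP; [left|right].
have h : x - signed_perm eps 1 x = (x k 0 *+ 2) *: canonical_basis R k.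
  apply/colP => j; rewrite !mxE perm1 /eps; case: eqP => [->|_].
    by rewrite mulN1r opprK eqxx mulr1.
  by rewrite mul1r subrr mulr0.
have := norm_sublinear.1 x (- signed_perm eps 1 x).
rewrite h is_normN one_symmetric_signed_perm//; case: p_norm => _ -> _.
by rewrite one_symmetric_basis mulr1 normrMn -mulr2n ler_pMn2r.
Qed.

Lemma norm_le_sum x : p x <= \sum_j `|x j 0|.
Proof.
rewrite {1}[x]sum_canonical_basis; elim/big_ind2 : _ => [|a b c d ab cd|k _].
- by rewrite is_norm0.
- by rewrite (le_trans (norm_sublinear.1 _ _))// lerD.
- by case: p_norm => _ -> _; rewrite one_symmetric_basis mulr1.
Qed.

Lemma is_norm_dist x y : `|p x - p y| <= p (x - y).
Proof.
rewrite ler_norml sublinearB ?andbT; last exact: norm_sublinear.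
rewrite lerNl opprB -(is_normN (x - y)) opprB sublinearB//.
exact: norm_sublinear.
Qed.

Lemma norm_lipschitz x y : `|p x - p y| <= N%:R * euclidean_norm (x - y).
Proof.
apply: le_trans (sum_le_euclidean _); apply: le_trans (norm_le_sum _).
exact: is_norm_dist.
Qed.

Lemma dual_norm_bounded f :
  has_sup [set `|dotp f x| | x in [set x | p x <= 1]].
Proof.
split; first by exists `|dotp f 0|, 0 => //=; rewrite is_norm0.
exists (\sum_j `|f j 0|) => _ [x /= x1 <-].
rewrite (le_trans (ler_norm_sum _ _ _))// ler_sum// => j _.
by rewrite normrM ler_piMr// (le_trans (coord_le_norm _ _)).
Qed.

(** The working form of a norming functional: a linear function that is
    dominated by p and touches it at x. *)
Lemma normingP x f : p x = 1 ->
  norming p x f <-> (forall y, dotp f y <= p y) /\ dotp f x = 1.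
Proof.
move=> x1; rewrite /norming x1; split=> -[f1 fx]; split=> //.
  move=> y; have [->|y0] := eqVneq y 0.
    by rewrite -(scale0r 0) dotpZr mul0r is_norm_ge0.
  have py := is_norm_gt0 y0.
  have : `|dotp f ((p y)^-1 *: y)| <= 1.
    rewrite -f1; apply: sup_upper_bound; first exact: dual_norm_bounded.
    exists ((p y)^-1 *: y) => //=.
    rewrite norm_sublinear.2 ?invr_ge0 ?(ltW py)//.
    by rewrite mulVf ?gt_eqF.
  rewrite dotpZr normrM gtr0_norm ?invr_gt0// mulrC ler_pdivrMr// mul1r.
  exact: le_trans (ler_norm _).
apply/eqP; rewrite eq_le; apply/andP; split.
  apply: sup_le_ub; first exact: (dual_norm_bounded _).1.
  move=> _ [y /= y1 <-]; apply: le_trans y1; rewrite ler_norml f1 andbT.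
  by rewrite lerNl -dotpNr -(is_normN y) f1.
apply: sup_upper_bound; first exact: dual_norm_bounded.
by exists x => /=; rewrite ?x1// fx normr1.
Qed.

(** A linear function dominated by the derivative of p at x is dominated by p,
    and it equals 1 at x because that derivative is linear along x. *)
Lemma norming_exists x v : p x = 1 ->
  exists2 f, norming p x f & dotp f v = dirderiv p x v.
Proof.
move=> x1; have ps := norm_sublinear.
have [f [fle fv]] := hahn_banach v (dirderiv_sublinear x ps).
exists f => //; apply/normingP => //; split=> [y|].
  exact: le_trans (fle y) (dirderiv_leq _ _ ps).
have [dl dx] := dirderiv_self x ps; apply/eqP; rewrite eq_le.
have := fle x; rewrite dx x1 => ->/=.
by rewrite -lerN2 -dotpNr (le_trans (fle _))// dl dx x1.
Qed.

Lemma smooth_star x : smooth_points p x -> norming p x (star p x).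
Proof. by move=> [_ [f [fx _]]]; exact: (xgetI 0 fx). Qed.

Lemma smooth_star_eq x f : smooth_points p x -> norming p x f -> f = star p x.
Proof.
move=> xD fx; have := smooth_star xD; case: xD => _ [g [_ gu]].
by move=> sx; rewrite -(gu _ fx) -(gu _ sx).
Qed.

(** By norming_exists the derivative in any direction is attained by some
    norming functional, and there is only one. *)
Lemma star_dirderiv x v : smooth_points p x ->
  dotp (star p x) v = dirderiv p x v.
Proof.
move=> xD; have [f fx <-] := norming_exists v xD.1.
by rewrite (smooth_star_eq xD fx).
Qed.

Lemma nonsmooth_two x : p x = 1 -> ~ smooth_points p x ->
  exists f g k, [/\ norming p x f, norming p x g & f k 0 < g k 0].
Proof.
move=> x1 xD; have [f fx _] := norming_exists 0 x1.
have [g gx fg] : exists2 g, norming p x g & f <> g.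
  apply: contrapT => h; apply: xD; split => //; exists f; split=> // g gx.
  by apply: contrapT => fg; apply: h; exists g.
have [k fgk] : exists k, f k 0 != g k 0.
  apply: contrapT => h; apply: fg; apply/colP => k; apply/eqP.
  by apply: contrapT => /negP fgk; apply: h; exists k.
by case: (ltgtP (f k 0) (g k 0)) fgk => // h _; [exists f, g, k|exists g, f, k].
Qed.

Lemma dominated_coord_le1 f k : (forall y, dotp f y <= p y) -> `|f k 0| <= 1.
Proof.
move=> fp; rewrite ler_norml -dotp_basis lerNl -dotpNr.
by rewrite -(one_symmetric_basis k) -{1}(is_normN (canonical_basis R k)) !fp.
Qed.

Lemma norming_signed_perm eps s x f : signs eps -> p x = 1 ->
  norming p x f -> norming p (signed_perm eps s x) (signed_perm eps s f).
Proof.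
move=> e1 x1 /(normingP _ x1)[fp fx]; apply/normingP.
  by rewrite one_symmetric_signed_perm.
split=> [y|]; last by rewrite dotp_signed_perm.
by rewrite -(signed_permVK s e1 y) dotp_signed_perm// one_symmetric_signed_perm.
Qed.

Lemma smooth_signed_perm eps s x : signs eps -> smooth_points p x ->
  smooth_points p (signed_perm eps s x).
Proof.
move=> e1 xD; have Tx1 : p (signed_perm eps s x) = 1.
  by rewrite one_symmetric_signed_perm// xD.1.
split=> //; exists (signed_perm eps s (star p x)); split.
  exact: norming_signed_perm e1 xD.1 (smooth_star xD).
move=> g gx; have := norming_signed_perm s^-1%g (signs_inv s e1) Tx1 gx.
rewrite -/(signed_perm_inv _ _ _) -/(signed_perm_inv _ _ _) signed_permK//.
by move=> /(smooth_star_eq xD) <-; rewrite signed_permVK.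
Qed.

Lemma star_signed_perm eps s x : signs eps -> smooth_points p x ->
  star p (signed_perm eps s x) = signed_perm eps s (star p x).
Proof.
move=> e1 xD; apply/esym/smooth_star_eq; first exact: smooth_signed_perm.
exact: norming_signed_perm e1 xD.1 (smooth_star xD).
Qed.

(** A fixed t nearly attains the infimum that defines the derivative at x; the
    same t bounds the derivative at nearby points, since p is Lipschitz. *)
Lemma star_usc x v (e : R) : smooth_points p x -> 0 < e ->
  \forall y \near within (smooth_points p) (nbhs x),
    dotp (star p y) v < dotp (star p x) v + e.
Proof.
move=> xD e0; have e20 : 0 < e / 2 by rewrite divr_gt0.
have [|t t0] := dirderiv_lt norm_sublinear (w := x) (v := v)
    (b := dirderiv p x v + e / 2); first by rewrite ltrDl.
rewrite xD.1 mulr1 => tx.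
(* then p (y - x) <= N d on the ball of radius d, and t N d < e / 2 *)
pose d := e / 2 / (1 + t * N%:R).
have D0 : 0 < 1 + t * N%:R by rewrite ltr_pwDl// mulr_ge0.
have d0 : 0 < d by rewrite divr_gt0.
apply/nbhs_ballP; exists d => //= y xy yD.
have pxy : p (y - x) <= N%:R * d.
  apply: (le_trans (norm_le_sum _)).
  apply: (@le_trans _ _ (\sum_(j < N) d)); last first.
    by rewrite sumr_const card_ord mulr_natl.
  apply: ler_sum => j _; rewrite !mxE distrC; apply: ltW.
  exact: (xy.2 j 0).
have td : t * (N%:R * d) < e / 2.
  rewrite /d -(ltr_pM2r D0) mulrA -[ltLHS]mulrA divfK ?gt_eqF//.
  by lra.
have := dirderiv_le y v norm_sublinear t0; rewrite -star_dirderiv// yD.1 mulr1.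
have := norm_sublinear.1 (v + t *: x) (t *: (y - x)).
rewrite -addrA -scalerDr (addrC x) subrK norm_sublinear.2//.
have := ler_wpM2l t0 pxy; rewrite (star_dirderiv v xD); lra.
Qed.

Lemma star_continuous : {within smooth_points p, continuous (star p)}.
Proof.
apply/subspace_continuousP => x xD; apply/cvg_ballP => e e0.
have h : forall i, \forall y \near within (smooth_points p) (nbhs x),
    ball (star p x i 0) e (star p y i 0).
  move=> i.
  have h1 := star_usc (canonical_basis R i) xD e0.
  have h2 := star_usc (- canonical_basis R i) xD e0.
  near=> y; rewrite /ball/= ltr_norml.
  have : dotp (star p y) (canonical_basis R i) <
    dotp (star p x) (canonical_basis R i) + e by near: y.
  have : dotp (star p y) (- canonical_basis R i) <
    dotp (star p x) (- canonical_basis R i) + e by near: y.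
  by rewrite !dotpNr !dotp_basis => ? ?; apply/andP; split; lra.
have hall := filter_forall _ h; near=> y; split=> // i j; rewrite ord1.
by move: i; near: y; exact: hall.
Unshelve. all: by end_near. Qed.

End SymmetricNorm.

Local Open Scope ereal_scope.

(** * Hausdorff measure of sets with Lipschitz parameters *)

Lemma lee_expe (R : realDomainType) (x y : \bar R) n : 0 <= x -> x <= y ->
  x ^+ n <= y ^+ n.
Proof.
move=> x0 xy; elim: n => [|n ih]; first by rewrite !expe0.
by rewrite !expeS lee_pmul// expe_ge0.
Qed.

Lemma outer_measure_finite_cover (R : realType) (T : Type)
    (mu : {outer_measure set T -> \bar R}) (F : finType) (U : F -> set T)
    (A : set T) :
  (forall x, A x -> exists i, U i x) -> mu A <= \sum_(i in F) mu (U i).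
Proof.
move=> AU.
pose V k : set T := if insub k is Some i then U (enum_val (i : 'I_#|F|))
                    else set0.
have VE (i : 'I_#|F|) : V i = U (enum_val i) by rewrite /V valK.
rewrite big_enum_val; under eq_bigr do rewrite -VE.
apply: le_trans (outer_measure_subadditive mu V #|F|).
apply: le_outer_measure => x /AU[i Uix].
rewrite -bigcup_mkord; exists (enum_rank i); first exact: ltn_ord.
by rewrite VE enum_rankK.
Qed.

Lemma outer_measure_countable_null (R : realType) (T : Type)
    (mu : {outer_measure set T -> \bar R}) (I : countType) (U : I -> set T)
    (A : set T) :
  (forall x, A x -> exists i, U i x) -> (forall i, mu (U i) = 0) -> mu A = 0.
Proof.
move=> AU U0; pose V k : set T := if unpickle k is Some i then U i else set0.
apply/eqP; rewrite eq_le outer_measure_ge0 andbT.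
apply: (@le_trans _ _ (mu (\bigcup_k V k))).
  apply: le_outer_measure => x /AU[i Uix]; exists (pickle i) => //.
  by rewrite /V pickleK.
apply: (le_trans (outer_measure_sigma_subadditive _ _)).
rewrite eseries0// => k _ _; rewrite /V.
by case: unpickle => [i|]; rewrite ?U0 ?outer_measure0.
Qed.

Section Hausdorff.
Variables (R : realType) (N s : nat).
Implicit Types (A B U : set 'cV[R]_N) (x y : 'cV[R]_N) (d r C : R).

Lemma diameter_le A r :
  (forall x y, A x -> A y -> euclidean_norm (x - y) <= r)%R ->
  diameter A <= r%:E.
Proof.
by move=> h; apply: ge_ereal_sup => _ [x Ax [y Ay <-]]; rewrite lee_fin h.
Qed.

Lemma euclidean_le_diameter A x y : A x -> A y ->
  (euclidean_norm (x - y))%:E <= diameter A.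
Proof. by move=> Ax Ay; apply: ereal_sup_ubound; exists x => //; exists y. Qed.

Lemma le_hausdorff_gauge A B : (B !=set0 -> A !=set0) ->
  diameter B <= diameter A -> hausdorff_gauge s B <= hausdorff_gauge s A.
Proof.
move=> AB dBA; rewrite {1}/hausdorff_gauge; case: ifPn => [_|/set0P B0].
  exact: hausdorff_gauge_ge0.
rewrite /hausdorff_gauge ifF ?lee_expe//; first exact: diameter_ge0.
by apply/negbTE/set0P/AB.
Qed.

Lemma hausdorff_gauge_le A r : (0 <= r)%R -> diameter A <= r%:E ->
  hausdorff_gauge s A <= (r ^+ s)%:E.
Proof.
move=> r0 Ar; rewrite /hausdorff_gauge; case: ifPn => [_|/set0P A0].
  by rewrite lee_fin exprn_ge0.
by rewrite EFin_expe lee_expe// diameter_ge0.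
Qed.

Lemma hausdorff_content_anti A d e : (d <= e)%R ->
  hausdorff_content s e A <= hausdorff_content s d A.
Proof.
move=> de; apply: ereal_inf_le_tmp => _ [U [dU AU] <-].
by exists U => //; split=> // k; rewrite (le_trans (dU k))// lee_fin.
Qed.

Lemma hausdorff_content_single A d : diameter A <= d%:E ->
  hausdorff_content s d A <= hausdorff_gauge s A.
Proof.
move=> dA; apply: ereal_inf_lbound.
exists (fun k : nat => (if k is 0%N then A else set0) : set 'cV[R]_N).
  split=> [[|k]//|x Ax]; last by exists 0%N.
  by rewrite diameter_set0 leNye.
rewrite nneseries_recl//; last by move=> k _; exact: hausdorff_gauge_ge0.
rewrite eseries0 ?adde0// => -[//|k] _ _; exact: hausdorff_gauge0.
Qed.

HB.instance Definition _ d :=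
  isOuterMeasure.Build R 'cV[R]_N (@hausdorff_content R N s d)
    (@hausdorff_content0 R N s d) (@hausdorff_content_ge0 R N s d)
    (@le_hausdorff_content R N s d)
    (@hausdorff_content_sigma_subadditive R N s d).

Lemma hausdorff_content_finite_cover (F : finType) (U : F -> set 'cV[R]_N)
    A d r :
  (0 <= r <= d)%R -> (forall i, diameter (U i) <= r%:E) ->
  (forall x, A x -> exists i, U i x) ->
  hausdorff_content s d A <= (#|F|%:R * r ^+ s)%:E.
Proof.
move=> /andP[r0 rd] dU AU.
apply: (le_trans (outer_measure_finite_cover
  (hausdorff_content s d : {outer_measure set 'cV[R]_N -> \bar R}) AU)) => /=.
apply: (@le_trans _ _ (\sum_(i in F) (r ^+ s)%:E)).
  apply: lee_sum => i _.
  apply: (le_trans (hausdorff_content_single _)); last first.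
    exact: hausdorff_gauge_le.
  by rewrite (le_trans (dU _))// lee_fin.
by rewrite sumEFin sumr_const mulr_natl.
Qed.

(** Sort the points of A by the cell containing phi: the cube [-1, 1]^J sits
    inside [-2, 2]^J, which is cut into (n+1)^#|J| cells of side 4/(n+1).  The
    larger cube keeps the value 1 strictly inside the last cell. *)
Lemma hausdorff_content_grid (J : finType) (phi : 'cV[R]_N -> J -> R) A C d n :
  (0 <= C)%R -> (forall x j, A x -> `|phi x j| <= 1)%R ->
  (forall x y r, A x -> A y -> 0 <= r ->
    (forall j, `|phi x j - phi y j| <= r)%R ->
    euclidean_norm (x - y) <= C * r)%R ->
  (C * (4 / n.+1%:R) <= d)%R ->
  hausdorff_content s d A <= ((n.+1 ^ #|J|)%:R * (C * (4 / n.+1%:R)) ^+ s)%:E.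
Proof.
move=> C0 phi1 phiC Cd.
pose z x j := ((phi x j + 2) / 4 * n.+1%:R)%R.
pose c x := [ffun j => inord (Num.truncn (z x j)) : 'I_n.+1].
have n0 : (0 < n.+1%:R :> R)%R by [].
have zb x j : A x -> (0 <= z x j < n.+1%:R)%R.
  move=> /(phi1 x j); rewrite ler_norml => /andP[l u]; rewrite /z.
  by rewrite mulr_ge0 ?divr_ge0//=; [rewrite gtr_pMl//|]; lra.
have cE x j : A x -> c x j = Num.truncn (z x j) :> nat.
  move=> Ax; have /andP[z0 zn] := zb x j Ax.
  by rewrite ffunE inordK// truncn_lt_nat.
have := @hausdorff_content_finite_cover {ffun J -> 'I_n.+1}
  (fun f => [set x | A x /\ c x = f]) A d (C * (4 / n.+1%:R)).
rewrite card_ffun card_ord; apply.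
- by rewrite Cd andbT mulr_ge0.
- move=> f; apply: diameter_le => x y [Ax cx] [Ay cy]; apply: phiC => // j.
  have /andP[x0 _] := zb x j Ax; have /andP[y0 _] := zb y j Ay.
  have /andP[lx ux] := truncn_itv x0; have /andP[ly uy] := truncn_itv y0.
  have xyj : Num.truncn (z x j) = Num.truncn (z y j) by rewrite -!cE// cx cy.
  rewrite xyj in lx ux.
  have : (`|z x j - z y j| <= 1)%R.
    by rewrite ler_norml; rewrite -natr1 in ux uy; lra.
  have -> : (z x j - z y j = (phi x j - phi y j) / (4 / n.+1%:R))%R.
    by rewrite /z; field; rewrite nat1r gt_eqF.
  have q0 : (0 < 4 / n.+1%:R :> R)%R by rewrite divr_gt0.
  rewrite normrM normfV (gtr0_norm q0).
  by rewrite ler_pdivrMr ?divr_gt0// mul1r.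
- by move=> x Ax; exists (c x).
Qed.

Lemma hausdorff_lipschitz_fin (J : finType) (phi : 'cV[R]_N -> J -> R) A C :
  (0 <= C)%R -> (forall x j, A x -> `|phi x j| <= 1)%R ->
  (forall x y r, A x -> A y -> 0 <= r ->
    (forall j, `|phi x j - phi y j| <= r)%R ->
    euclidean_norm (x - y) <= C * r)%R ->
  #|J| = s -> hausdorff s A <= ((C * 4) ^+ s)%:E.
Proof.
move=> C0 phi1 phiC Js; apply: ge_ereal_sup => _ [d /= d0 <-].
pose n := Num.truncn (C * 4 / d)%R.
have nd : (C * (4 / n.+1%:R) <= d)%R.
  rewrite mulrA ler_pdivrMr// (mulrC d) -ler_pdivrMr//.
  by rewrite ltW// truncnS_gt.
apply: (le_trans (hausdorff_content_grid C0 phi1 phiC nd)).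
by rewrite lee_fin Js natrX mulrA exprMn mulrCA exprVn mulfV ?mulr1// expf_neq0.
Qed.

(** With fewer parameters than the dimension s, the grid bound is
    (n+1)^#|J| (4C/(n+1))^s <= (4C)^s / (n+1), for every large n. *)
Lemma hausdorff_lipschitz_null (J : finType) (phi : 'cV[R]_N -> J -> R) A C :
  (0 <= C)%R -> (forall x j, A x -> `|phi x j| <= 1)%R ->
  (forall x y r, A x -> A y -> 0 <= r ->
    (forall j, `|phi x j - phi y j| <= r)%R ->
    euclidean_norm (x - y) <= C * r)%R ->
  (#|J| < s)%N -> hausdorff s A = 0.
Proof.
move=> C0 phi1 phiC Js; apply/eqP; rewrite eq_le hausdorff_ge0 andbT.
apply: ge_ereal_sup => _ [d /= d0 <-]; apply/lee_addgt0Pr => e e0.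
rewrite add0e.
pose n := maxn (Num.truncn (C * 4 / d)%R) (Num.truncn ((C * 4) ^+ s / e)%R).
have nle (a b : R) : (0 < b)%R -> (Num.truncn (a / b) <= n)%N ->
    (a / n.+1%:R <= b)%R.
  move=> b0 an; rewrite ler_pdivrMr// mulrC -ler_pdivrMr//.
  by rewrite (le_trans (ltW (truncnS_gt _)))// ler_nat.
have nd : (C * (4 / n.+1%:R) <= d)%R by rewrite mulrA nle// leq_maxl.
apply: (le_trans (hausdorff_content_grid C0 phi1 phiC nd)).
apply: (@le_trans _ _ ((C * 4) ^+ s / n.+1%:R)%:E); last first.
  by rewrite lee_fin nle// leq_maxr.
rewrite lee_fin natrX mulrA exprMn mulrCA ler_wpM2l ?exprn_ge0 ?mulr_ge0//.
rewrite exprVn ler_pdivrMr ?exprn_gt0// mulrC.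
rewrite -(subnKC Js) exprD exprSr -!mulrA ler_peMr ?exprn_ge0//.
rewrite mulrCA divff// mulr1.
by rewrite exprn_ege1// ler1n.
Qed.

Lemma hausdorff_preimage_le (T : 'cV[R]_N -> 'cV[R]_N) A :
  (forall x y, euclidean_norm (T x - T y) = euclidean_norm (x - y)) ->
  hausdorff s (T @^-1` A) <= hausdorff s A.
Proof.
move=> Tiso; apply: ge_ereal_sup => _ [d /= d0 <-].
apply: le_trans (hausdorff_content_le _ _ d0).
have Tdiam U : diameter (T @^-1` U) <= diameter U.
  apply: ge_ereal_sup => _ [x Ux [y Uy <-]]; rewrite -Tiso.
  exact: euclidean_le_diameter.
apply: le_ereal_inf_tmp => _ [U [dU AU] <-].
apply: (@le_trans _ _ (\sum_(k <oo) hausdorff_gauge s (T @^-1` U k))).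
  apply: ereal_inf_lbound; exists (fun k => T @^-1` U k) => //; split.
    by move=> k; exact: le_trans (Tdiam _) (dU k).
  by move=> x /AU [k _ Uk]; exists k.
apply: lee_nneseries => [k _ _|k _]; first exact: hausdorff_gauge_ge0.
by apply: le_hausdorff_gauge => // -[x Ux]; exists (T x).
Qed.

Lemma hausdorff_preimage (T T' : 'cV[R]_N -> 'cV[R]_N) A :
  cancel T T' -> cancel T' T ->
  (forall x y, euclidean_norm (T x - T y) = euclidean_norm (x - y)) ->
  hausdorff s (T @^-1` A) = hausdorff s A.
Proof.
move=> TK T'K Tiso; apply/eqP; rewrite eq_le hausdorff_preimage_le//=.
have {1}-> : A = T' @^-1` (T @^-1` A).
  by apply/seteqP; split=> x /=; rewrite T'K.
by apply: hausdorff_preimage_le => x y; rewrite -{2}(T'K x) -{2}(T'K y) Tiso.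
Qed.

End Hausdorff.

(** * Covers of a cube by boxes *)

(** Induction on the dimension.  Fixing the last coordinate t leaves a cover of
    the smaller cube by the boxes whose last side contains t, so the sum of
    their d_k^s is at least 1; integrating over t in [0, 1] turns each d_k^s
    into at most d_k^s times the length d_k of that side.  The flag b k marks
    the boxes in use, and a k i is their lower corner. *)
Lemma box_cover (R : realType) (s : nat) (b : nat -> bool)
    (a : nat -> nat -> R) (d : nat -> R) :
  (forall k, (0 <= d k)%R) ->
  (forall u : nat -> R, (forall i, (0 <= u i <= 1)%R) ->
    exists k, b k /\ forall i, (i < s)%N -> (a k i <= u i <= a k i + d k)%R) ->
  1 <= \sum_(k <oo) (if b k then d k ^+ s else 0)%:E.
Proof.
move=> d0; elim: s b => [|s ih] b cov.
  have [|k [bk _]] := cov (fun=> 0%R); first by move=> i; rewrite lexx ler01.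
  rewrite (nneseriesD1 (n := k))//= ?bk; last first.
    by move=> i _; rewrite lee_fin; case: ifP.
  rewrite expr0 leeDl// nneseries_ge0// => i _ _.
  by rewrite lee_fin; case: ifP.
pose I k : set R := `[a k s, (a k s + d k)%R]%classic.
pose D : set R := `[0%R, 1%R]%classic.
have mI k : measurable (I k) by exact: measurable_itv.
have mD : measurable D by exact: measurable_itv.
pose c k : R := (if b k then d k ^+ s else 0)%R.
have c0 k : (0 <= c k)%R by rewrite /c; case: ifP => // _; exact: exprn_ge0.
pose f (k : nat) (t : R) : \bar R := (c k * \1_(I k) t)%:E.
have f0 k t : 0 <= f k t by rewrite lee_fin mulr_ge0.
have mf k : measurable_fun D (f k).
  by apply/measurable_EFinP; apply: measurable_funM.
have slice (t : R) : D t -> 1 <= \sum_(k <oo) f k t.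
  rewrite /D/= in_itv/= => t01.
  have -> : \sum_(k <oo) f k t =
      \sum_(k <oo) (if b k && (t \in I k) then d k ^+ s else 0)%:E.
    apply: eq_eseriesr => k _; rewrite /f /c indicE.
    by case: (b k); case: (t \in I k); rewrite /= ?mulr1 ?mulr0.
  apply: ih => u u01.
  have [i|k [bk uk]] := cov (fun i => if i == s then t else u i).
    by case: ifP.
  exists k; split; last first.
    by move=> i is_; have := uk i (ltnW is_); rewrite ltn_eqF.
  rewrite bk/=; apply/mem_set; rewrite /I/= in_itv/=.
  by have := uk s (leqnn _); rewrite eqxx.
have mu01 : lebesgue_measure D = 1.
  by rewrite lebesgue_measure_itv/= lte_fin ltr01 oppr0 adde0.
have -> : 1 = \int[lebesgue_measure]_(t in D) (cst 1 t) :> \bar R.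
  by rewrite integral_cst//= mu01 mule1.
apply: (@le_trans _ _
    (\int[lebesgue_measure]_(t in D) \sum_(k <oo) f k t)).
  apply: ge0_le_integral => //.
  apply: (ge0_emeasurable_sum (P := xpredT) (h := f)) => *; first exact: f0.
  exact: mf.
rewrite integral_nneseries//; apply: lee_nneseries => [k _ _|k _].
  exact: integral_ge0.
have -> : \int[lebesgue_measure]_(t in D) f k t =
    (c k)%:E * lebesgue_measure (I k `&` D).
  have -> : lebesgue_measure (I k `&` D) =
      \int[lebesgue_measure]_(t in D) (\1_(I k) t)%:E.
    by symmetry; exact: (integral_indic (@lebesgue_measure R) mD (mI k)).
  have ck : (c k < 0)%R -> I k = set0 by move=> /lt_geF; rewrite c0.
  exact: (@integralZl_indic _ _ _ (@lebesgue_measure R) _ mD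
    (fun=> I k) _ ck (mI k)).
have Ik : lebesgue_measure (I k) <= (d k)%:E.
  rewrite lebesgue_measure_itv/=; case: ifP => _; rewrite -?EFinB lee_fin//.
  lra.
apply: (@le_trans _ _ ((c k)%:E * (d k)%:E)).
  rewrite lee_wpmul2l ?lee_fin//; apply: le_trans Ik.
  apply: le_measure; rewrite ?inE//.
  - exact: (measurableI _ _ (mI k) mD).
  - exact: mI.
by rewrite -EFinM lee_fin /c; case: ifP; rewrite ?mul0r// exprSr.
Qed.

(** A set of diameter D of the cover meets the image of the cube only at
    parameters within C D of a chosen one, that is, inside a box of side 2 C D;
    those boxes cover the cube. *)
Lemma hausdorff_lower_bound (R : realType) (N s : nat) (A : set 'cV[R]_N)
    (x : (nat -> R) -> 'cV[R]_N) (C : R) : (0 < C)%R ->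
  (forall u, (forall i, 0 <= u i <= 1)%R -> A (x u)) ->
  (forall u v i, (forall i, 0 <= u i <= 1)%R -> (forall i, 0 <= v i <= 1)%R ->
    (i < s)%N -> (`|u i - v i| <= C * euclidean_norm (x u - x v))%R) ->
  (((2 * C) ^+ s)^-1)%:E <= hausdorff s A.
Proof.
move=> C0 xA xC; apply: le_trans (hausdorff_content_le s A (@ltr01 R)).
apply: le_ereal_inf_tmp => _ [U [U1 AU] <-].
have M0 : (0 < (2 * C) ^+ s)%R by rewrite exprn_gt0// mulr_gt0.
pose hit k (u : nat -> R) := (forall i, (0 <= u i <= 1)%R) /\ U k (x u).
pose b k := `[< exists u, hit k u >].
pose D k : R := if b k then fine (diameter (U k)) else 0%R.
pose w k : nat -> R := xget (fun=> 0%R) (hit k).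
have bw k : b k -> hit k (w k).
  by move=> /asboolP[u hu]; exact: (xgetI _ hu).
have bD k : b k -> (D k)%:E = diameter (U k).
  move=> bk; rewrite /D bk fineK// ge0_fin_numE.
    by rewrite (le_lt_trans (U1 k))// ltry.
  by apply: diameter_ge0; exists (x (w k)); exact: (bw k bk).2.
have D0 k : (0 <= D k)%R.
  have [bk|/negbTE nbk] := boolP (b k); last by rewrite /D nbk.
  rewrite -lee_fin bD//; apply: diameter_ge0.
  by exists (x (w k)); exact: (bw k bk).2.
have := @box_cover R s b
  (fun k i => w k i - C * D k)%R (fun k => 2 * C * D k)%R.
move=> /(_ _ _)/wrap[k|u u01|h1].
- by rewrite mulr_ge0// mulr_ge0// ltW.
- have [k _ Uk] := AU _ (xA _ u01).
  have bk : b k by apply/asboolP; exists u.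
  exists k; split=> // i si.
  have : (`|u i - w k i| <= C * D k)%R.
    have [w01 Uw] := bw k bk.
    apply: (le_trans (xC _ _ _ u01 w01 si)); rewrite ler_pM2l//.
    by rewrite -lee_fin bD// euclidean_le_diameter.
  by rewrite ler_norml => /andP[l r]; apply/andP; split; lra.
- rewrite -[leLHS]mule1 -lee_pdivlMl ?invr_gt0// invrK.
  rewrite -nneseriesZl; last by move=> k _; exact: hausdorff_gauge_ge0.
  apply: (le_trans h1); apply: lee_nneseries => [k _ _|k _].
    by case: ifP => _; rewrite lee_fin// exprn_ge0// !mulr_ge0// ltW.
  case: ifP => [bk|_]; last first.
    by rewrite mule_ge0 ?hausdorff_gauge_ge0// lee_fin ltW.
  rewrite exprMn EFinM /hausdorff_gauge ifF ?EFin_expe ?bD//.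
  apply/negbTE/set0P; exists (x (w k)); exact: (bw k bk).2.
Qed.

(** * The Caratheodory criterion for Lipschitz sublevel sets *)

Section MetricOuterMeasure.
Variables (R : realType) (N s : nat) (phi : 'cV[R]_N -> R) (L : R).
Hypothesis L0 : (0 < L)%R.
Hypothesis phi_lip :
  forall x y, (`|phi x - phi y| <= L * euclidean_norm (x - y))%R.
Implicit Types (A X Y : set 'cV[R]_N) (a b c : R).
Local Notation H := (@hausdorff R N s).

(** Sets of diameter at most d are too small to meet both X and Y, so a cover
    of the union splits into a cover of X and one of Y. *)
Lemma hausdorff_content_separated X Y a b d : (a < b)%R ->
  (L * d < b - a)%R ->
  (forall x, X x -> phi x <= a)%R -> (forall y, Y y -> b <= phi y)%R ->
  hausdorff_content s d X + hausdorff_content s d Y <=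
  hausdorff_content s d (X `|` Y).
Proof.
move=> ab Ld Xa Yb; apply: le_ereal_inf_tmp => _ [U [dU XYU] <-].
pose meets Z k := if `[< (U k `&` Z) !=set0 >] then U k else set0.
have cov Z : Z `<=` X `|` Y -> hausdorff_content s d Z <=
    \sum_(k <oo) hausdorff_gauge s (meets Z k).
  move=> ZXY; apply: ereal_inf_lbound; exists (meets Z) => //; split.
    by move=> k; rewrite /meets; case: ifP => _ //; rewrite diameter_set0 leNye.
  move=> x Zx; have [k _ Ukx] := XYU _ (ZXY _ Zx); exists k => //.
  by rewrite /meets; case: asboolP => // nk; exfalso; apply: nk; exists x.
apply: (@le_trans _ _ (\sum_(k <oo) hausdorff_gauge s (meets X k) +
    \sum_(k <oo) hausdorff_gauge s (meets Y k))).
  by apply: leeD; apply: cov => x; [left|right].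
rewrite -nneseriesD; [|by move=> *; exact: hausdorff_gauge_ge0..].
apply: lee_nneseries => [k _ _|k _].
  by rewrite adde_ge0// hausdorff_gauge_ge0.
rewrite /meets; case: asboolP => [[x [Ux Xx]]|_]; last first.
  rewrite hausdorff_gauge0 add0e; case: ifP => // _.
  by rewrite hausdorff_gauge0 hausdorff_gauge_ge0.
case: asboolP => [[y [Uy Yy]]|_]; last by rewrite hausdorff_gauge0 adde0.
exfalso.
have : (euclidean_norm (y - x) <= d)%R.
  by rewrite -lee_fin (le_trans (euclidean_le_diameter Uy Ux)).
rewrite -(ler_pM2l L0) => yx.
have := phi_lip y x; rewrite ler_norml => /andP[_].
by have := Xa _ Xx; have := Yb _ Yy; lra.
Qed.

Lemma hausdorff_separated X Y a b : (a < b)%R ->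
  (forall x, X x -> phi x <= a)%R -> (forall y, Y y -> b <= phi y)%R ->
  H X + H Y <= H (X `|` Y).
Proof.
move=> ab Xa Yb.
have [->|XY] := eqVneq (H (X `|` Y)) +oo; first exact: leey.
have fin Z : Z `<=` X `|` Y -> H Z \is a fin_num.
  move=> ZXY; rewrite ge0_fin_numE ?hausdorff_ge0//.
  by rewrite (le_lt_trans (le_hausdorff _ ZXY))// ltey.
have finX : H X \is a fin_num by apply: fin => x; left.
have finY : H Y \is a fin_num by apply: fin => x; right.
rewrite -leeBrDr//; apply: ge_ereal_sup => _ [d /= d0 <-].
have finC Z e : (0 < e)%R -> H Z \is a fin_num ->
    hausdorff_content s e Z \is a fin_num.
  move=> e0; rewrite !ge0_fin_numE ?hausdorff_ge0 ?hausdorff_content_ge0//.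
  by move=> /(le_lt_trans _); apply; exact: hausdorff_content_le.
rewrite leeBrDr// addeC -leeBrDr ?finC//.
apply: ge_ereal_sup => _ [e /= e0 <-]; rewrite leeBrDr ?finC// addeC.
pose r := Order.min (Order.min d e) ((b - a) / (2 * L))%R.
have ba0 : (0 < (b - a) / (2 * L))%R by rewrite divr_gt0 ?subr_gt0 ?mulr_gt0.
have r0 : (0 < r)%R by rewrite !lt_min d0 e0 ba0.
have rb : (L * r < b - a)%R.
  have : (r <= (b - a) / (2 * L))%R by rewrite ge_min lexx orbT.
  by rewrite ler_pdivlMr ?mulr_gt0//; have := mulr_gt0 L0 r0; lra.
apply: le_trans (hausdorff_content_le s _ r0).
apply: le_trans (hausdorff_content_separated ab rb Xa Yb).
by apply: leeD; apply: hausdorff_content_anti; rewrite !ge_min lexx ?orbT.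
Qed.

(** Superadditivity on separated sets bounds the partial sums of the measures of
    the rings by the finite measure of A, so the tails are small. *)
Lemma hausdorff_rings A (E : nat -> set 'cV[R]_N) (u v : nat -> R) (e : R) :
  H A < +oo -> (forall i, E i `<=` A) ->
  (forall i x, E i x -> (u i <= phi x <= v i)%R) ->
  (forall i j, (i <= j)%N -> (u j <= u i)%R) ->
  (forall i, (v i.+1 < u i)%R) -> (0 < e)%R ->
  exists n, H (\bigcup_(i in ~` `I_n) E i) <= e%:E.
Proof.
move=> Afin EA Euv uu vu e0.
have sumE n : \sum_(0 <= i < n) H (E i) <= H (\big[setU/set0]_(i < n) E i).
  elim: n => [|n ih]; first by rewrite big_geq// hausdorff_ge0.
  rewrite big_nat_recr//= big_ord_recr/= setUC addeC.
  apply: le_trans (leeD (lexx _) ih) _.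
  case: n ih => [|n] ih.
    by rewrite !big_ord0 hausdorff0 adde0 setU0.
  apply: (@hausdorff_separated _ _ (v n.+1) (u n)); first exact: vu.
    by move=> x /Euv/andP[].
  move=> x; rewrite -bigcup_mkord => -[i /= ni /Euv/andP[ux _]].
  by rewrite (le_trans _ ux)// uu.
have : \sum_(i <oo) H (E i) < +oo.
  apply: le_lt_trans Afin; apply: lime_le.
    by apply: is_cvg_nneseries => *; exact: hausdorff_ge0.
  apply: nearW => n; apply: (le_trans (sumE n)); apply: le_hausdorff => x.
  by rewrite -bigcup_mkord => -[i _ /EA].
move=> /nneseries_tail_cvg/(_ (fun k _ => hausdorff_ge0 _ _)).
move=> /fine_cvgP[[n1 _ fin] /cvgrPdist_le/(_ _ e0)[n2 _ small]].
exists (maxn n1 n2).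
apply: (le_trans (outer_measure_sigma_subadditive_tail
  (H : {outer_measure set 'cV[R]_N -> \bar R}) _ E)).
rewrite -[leLHS]fineK ?lee_fin; last by apply: fin; exact: leq_maxl.
have := small (maxn n1 n2) (leq_maxr _ _).
by rewrite /= sub0r normrN; exact: le_trans (ler_norm _).
Qed.

(** The part of A outside the sublevel set is exhausted by the sets where
    phi >= t_n with t_n = c + 1/(n+1), which are separated from it.  What is
    left, where c < phi < t_n, is covered by the rings t_(k+1) <= phi <= t_k;
    the even rings are separated from each other, and so are the odd ones. *)
Lemma hausdorff_caratheodory c :
  (H : {outer_measure set 'cV[R]_N -> \bar R}).-caratheodory
    [set x | (phi x <= c)%R].
Proof.
apply: le_caratheodory_measurable => /= A; set F := [set x | (phi x <= c)%R].
have [->|Aoo] := eqVneq (H A) +oo; first exact: leey.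
have Afin : H A < +oo by rewrite ltey.
apply/lee_addgt0Pr => e e0; have e2 : (0 < e / 2)%R by rewrite divr_gt0.
pose t k : R := (c + k.+1%:R^-1)%R.
have tlt i j : (i < j)%N -> (t j < t i)%R.
  by move=> ij; rewrite /t ltrD2l ltf_pV2 ?posrE// ltr_nat.
have tle i j : (i <= j)%N -> (t j <= t i)%R.
  by move=> ij; rewrite /t lerD2l lef_pV2 ?posrE// ler_nat.
pose E k := A `&` [set x | (t k.+1 <= phi x <= t k)%R].
have rings (f : nat -> nat) : (forall i, (f i.+1 = (f i).+2)%N) ->
    exists n, H (\bigcup_(i in ~` `I_n) E (f i)) <= (e / 2)%:E.
  move=> f2.
  have fle i j : (i <= j)%N -> (f i <= f j)%N.
    move=> /subnKC <-; elim: (j - i)%N => [|k ih]; first by rewrite addn0.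
    by rewrite addnS f2 (leq_trans ih)// -addn2 leq_addr.
  apply: (@hausdorff_rings A (E \o f)
    (fun i => t (f i).+1) (fun i => t (f i))) => //.
  - by move=> i x [].
  - by move=> i x [].
  - by move=> i j ij; apply: tle; rewrite ltnS fle.
  - by move=> i; apply: tlt; rewrite f2.
have [n1 H1] := rings double (fun i => doubleS i).
have [n2 H2] := rings (fun i => i.*2.+1) (fun i => congr1 S (doubleS i)).
pose n := (maxn n1 n2).*2.
pose An := A `&` [set x | (t n <= phi x)%R].
have cover : A `&` ~` F `<=` An `|` (\bigcup_(i in ~` `I_n1) E i.*2 `|`
    \bigcup_(i in ~` `I_n2) E i.*2.+1).
  move=> x [Ax /negP]; rewrite -ltNge => cx.
  have [nx|xn] := leP (t n) (phi x); first by left.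
  right; have px0 : (0 < phi x - c)%R by rewrite subr_gt0.
  pose m := Num.truncn (phi x - c)^-1%R.
  have /andP[ml mu] : (m%:R <= (phi x - c)^-1 < m.+1%:R)%R.
    by apply: truncn_itv; rewrite invr_ge0 ltW.
  have nm : (n < m)%N.
    rewrite truncn_ge_nat; last by rewrite invr_ge0 ltW.
    rewrite -lef_pV2 ?posrE ?invr_gt0// invrK ltW//.
    by rewrite ltrBlDl.
  case: m ml mu nm => // m ml mu nm.
  have Em : E m x.
    split => //; rewrite /t; apply/andP; split.
      by rewrite -lerBrDl -lef_pV2 ?posrE ?invr_gt0// invrK ltW.
    by rewrite -lerBlDl -lef_pV2 ?posrE ?invr_gt0// invrK.
  have nm2 : (maxn n1 n2 <= m./2)%N by rewrite -leq_double -/n; lia.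
  have [om|em] := boolP (odd m).
    right; exists m./2.
      by apply/negP; rewrite -leqNgt (leq_trans (leq_maxr _ _) nm2).
    by rewrite -[in i in E i](odd_double_half m) om add1n in Em *.
  left; exists m./2; last by rewrite even_halfK.
  by apply/negP; rewrite -leqNgt (leq_trans (leq_maxl _ _) nm2).
have tail : H (A `&` ~` F) <= H An + e%:E.
  apply: (le_trans (le_hausdorff _ cover)).
  apply: (le_trans (outer_measureU2
    (H : {outer_measure set 'cV[R]_N -> \bar R}) _ _)); apply: leeD => //.
  apply: (le_trans (outer_measureU2
    (H : {outer_measure set 'cV[R]_N -> \bar R}) _ _)).
  by rewrite [e in leRHS]splitr EFinD leeD.
apply: (le_trans (leeD (lexx _) tail)); rewrite addeA leeD//.
have ct : (c < t n)%R by rewrite /t ltrDl invr_gt0.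
apply: le_trans (hausdorff_separated ct _ _) _; try by move=> x [].
by apply: le_hausdorff => x [[]|[]].
Qed.

End MetricOuterMeasure.

Local Close Scope ereal_scope.

(** * Hausdorff measure of the unit sphere *)

Section Sphere.
Variables (R : realType) (N : nat) (p : 'cV[R]_N -> R).
Hypothesis N_gt0 : (0 < N)%N.
Hypothesis p_norm : is_norm p.
Hypothesis p_sym : one_symmetric p (@canonical_basis R N).
Implicit Types (x y f g v : 'cV[R]_N) (k : 'I_N).

Let ps := norm_sublinear p_norm.
Let pZ a x : p (a *: x) = `|a| * p x.
Proof. by case: p_norm => _ ->. Qed.

Lemma radial_lipschitz x y : 1 <= p x -> 1 <= p y ->
  p ((p x)^-1 *: x - (p y)^-1 *: y) <= 2 * p (x - y).
Proof.
move=> x1 y1; have x0 : 0 < p x by exact: lt_le_trans x1.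
have y0 : 0 < p y by exact: lt_le_trans y1.
have -> : (p x)^-1 *: x - (p y)^-1 *: y =
    (p x)^-1 *: (x - y) + ((p x)^-1 - (p y)^-1) *: y.
  by rewrite scalerBr scalerBl addrA subrK.
apply: (le_trans (ps.1 _ _)); rewrite !pZ mulr_natl mulr2n.
rewrite gtr0_norm ?invr_gt0//; apply: lerD.
  by rewrite ler_piMl ?is_norm_ge0// invf_le1.
have -> : (p x)^-1 - (p y)^-1 = (p y - p x) / (p x * p y).
  by field; rewrite !gt_eqF.
rewrite normrM [`|(_ * _)^-1|]gtr0_norm ?invr_gt0 ?mulr_gt0// invfM.
rewrite -!mulrA mulVf ?gt_eqF// mulr1.
apply: (@le_trans _ _ `|p y - p x|); first by rewrite ler_piMr// invf_le1.
by rewrite distrC is_norm_dist.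
Qed.

(** Where e x_j > 0, with e a sign, x is determined by x / (e x_j), its radial
    projection onto the face e x_j = 1; the projections have norm at least 1, so
    going back to the sphere is Lipschitz. *)
Lemma facet_lipschitz (j : 'I_N) (e : R) x y :
  `|e| = 1 -> p x = 1 -> p y = 1 -> 0 < e * x j 0 -> 0 < e * y j 0 ->
  euclidean_norm (x - y) <=
  2 * N%:R * \sum_i `|x i 0 / (e * x j 0) - y i 0 / (e * y j 0)|.
Proof.
move=> e1 px py x0 y0.
have facet z : p z = 1 -> 0 < e * z j 0 ->
    let w := (e * z j 0)^-1 *: z in 1 <= p w /\ z = (p w)^-1 *: w.
  move=> pz z0 w; rewrite /w pZ pz mulr1 gtr0_norm ?invr_gt0//; split.
    rewrite invf_ge1// (le_trans (ler_norm _))// normrM e1 mul1r -pz.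
    exact: coord_le_norm.
  by rewrite scalerA invrK mulfV ?gt_eqF// scale1r.
have [wx xE] := facet _ px x0; have [wy yE] := facet _ py y0.
apply: (le_trans (euclidean_le_sum _)).
apply: (@le_trans _ _ (\sum_(i < N) p (x - y))).
  by apply: ler_sum => i _; exact: coord_le_norm.
rewrite sumr_const card_ord -[leLHS]mulr_natl [2 * _]mulrC -mulrA.
rewrite ler_wpM2l// {1}xE {1}yE (le_trans (radial_lipschitz wx wy))//.
rewrite ler_wpM2l// (le_trans (norm_le_sum p_norm p_sym _))//.
apply: ler_sum => i _; rewrite !mxE [(_)^-1 * _]mulrC.
by rewrite [(e * y j 0)^-1 * _]mulrC.
Qed.

Lemma facet_axis (e z : R) : 0 < e * z -> z / (e * z) = e^-1.
Proof.
move=> z0; rewrite invfM mulrCA mulfV ?mulr1//.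
by apply: contraTneq z0 => ->; rewrite mulr0 ltxx.
Qed.

(** The sphere is the union of 2 N pieces, according to the position and the
    sign of a coordinate of largest absolute value; on each piece the other
    N-1 projected coordinates are Lipschitz parameters in [-1, 1]. *)
Lemma hausdorff_sphere_lt_pinfty :
  (hausdorff N.-1 (unit_sphere p) < +oo)%E.
Proof.
pose facet (je : 'I_N * bool) : set 'cV[R]_N := [set x | unit_sphere p x /\
  forall i, `|x i 0| <= (-1) ^+ je.2 * x je.1 0].
have cover x : unit_sphere p x -> exists je, facet je x.
  move=> x1; pose i0 : 'I_N := Ordinal N_gt0.
  pose j := [arg max_(i > i0) `|x i 0|]%O.
  have jmax i : `|x i 0| <= `|x j 0|.
    by rewrite /j; case: arg_maxP => // j' _ /(_ i isT).
  exists (j, x j 0 < 0); split=> // i; apply: (le_trans (jmax i)).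
  by rewrite [leRHS]/= -real_normrEsign ?num_real.
apply: (le_lt_trans (outer_measure_finite_cover
  (@hausdorff R N N.-1 : {outer_measure set 'cV[R]_N -> \bar R}) cover)).
apply: lte_sum_pinfty => -[j b] _ /=; set e : R := (-1) ^+ b.
have e1 : `|e| = 1 by rewrite normrX normrN1 expr1n.
have pos x : facet (j, b) x -> 0 < e * x j 0.
  move=> [x1 xm]; rewrite lt_neqAle (le_trans _ (xm j)) ?andbT//.
  apply/negP => /eqP e0; have : x = 0.
    apply/colP => i; rewrite mxE; apply/eqP; rewrite -normr_le0.
    by rewrite (le_trans (xm i))//= -e0.
  move=> x0; move: x1; rewrite /unit_sphere/= x0 is_norm0// => /esym/eqP.
  by rewrite oner_eq0.
pose phi x (i : {i : 'I_N | i != j}) := x (val i) 0 / (e * x j 0).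
apply: (@le_lt_trans _ _ ((2 * N%:R * N%:R * 4) ^+ N.-1)%:E); last exact: ltry.
apply: (@hausdorff_lipschitz_fin _ _ _ _ phi).
- by rewrite !mulr_ge0.
- move=> x i Ax; rewrite /phi normrM normfV (gtr0_norm (pos _ Ax)).
  by rewrite ler_pdivrMr ?pos// mul1r; exact: Ax.2.
- move=> x y r Ax Ay r0 xyr.
  have x0 := pos _ Ax; have y0 := pos _ Ay.
  apply: (le_trans (facet_lipschitz e1 Ax.1 Ay.1 x0 y0)).
  rewrite -[leRHS]mulrA ler_wpM2l ?mulr_ge0//.
  have diff i : `|x i 0 / (e * x j 0) - y i 0 / (e * y j 0)| <= r.
    have [->|ij] := eqVneq i j; last exact: (xyr (exist _ i ij)).
    by rewrite !facet_axis// subrr normr0.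
  apply: (@le_trans _ _ (\sum_(i < N) r)); first exact: ler_sum.
  by rewrite sumr_const card_ord mulr_natl.
- by rewrite card_sig cardC1 card_ord.
Qed.

Definition subgradient x f := (forall y, dotp f y <= p y) /\ dotp f x = p x.

(** The points, of any norm, at which the k-th coordinates of the subgradients
    spread over [r, s].  Without a normalisation this set is a cone. *)
Definition kink k (r s : R) : set 'cV[R]_N := [set x | exists f g,
  [/\ subgradient x f, subgradient x g, f k 0 <= r & s <= g k 0]].

(** If x_k <= y_k, take a subgradient g at x with g_k >= s and a subgradient f
    at y with f_k <= r.  Then <g - f, y - x> <= 0, so the k-th term of this sum,
    at least (s - r) (y_k - x_k), is compensated by the other terms, whose
    coefficients are at most 2. *)
Lemma kink_lipschitz k r s x y : r < s -> kink k r s x -> kink k r s y ->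
  (s - r) * `|x k 0 - y k 0| <= 2 * \sum_(i | i != k) `|x i 0 - y i 0|.
Proof.
move=> rs; wlog xy : x y / x k 0 <= y k 0.
  move=> h xk yk; have [le_xy|/ltW le_yx] := leP (x k 0) (y k 0).
    exact: h.
  by rewrite distrC; under eq_bigr do rewrite distrC; exact: h.
move=> [_ [g [_ [gp gx] _ sg]]] [f [_ [[fp fy] _ fr _]]].
rewrite distrC ger0_norm ?subr_ge0//.
have mono : \sum_i (g i 0 - f i 0) * (y i 0 - x i 0) <= 0.
  have -> : \sum_i (g i 0 - f i 0) * (y i 0 - x i 0) =
      (dotp g y - dotp g x) - (dotp f y - dotp f x).
    rewrite -!dotpBr /dotp -sumrB; apply: eq_bigr => i _.
    by rewrite !mxE mulrBl.
  by have := gp y; have := fp x; rewrite gx fy; lra.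
rewrite (bigD1 k)//= in mono.
have t0 : 0 <= y k 0 - x k 0 by rewrite subr_ge0.
apply: (@le_trans _ _ ((g k 0 - f k 0) * (y k 0 - x k 0))).
  by apply: ler_wpM2r => //; lra.
apply: (@le_trans _ _
    (- \sum_(i < N | i != k) (g i 0 - f i 0) * (y i 0 - x i 0))); first by lra.
rewrite -sumrN mulr_sumr; apply: ler_sum => i _.
apply: (le_trans (ler_norm _)); rewrite normrN normrM distrC.
rewrite [`|y i 0 - _|]distrC.
rewrite ler_wpM2r// (le_trans (ler_normB _ _))//.
by have := dominated_coord_le1 p_norm p_sym i fp;
  have := dominated_coord_le1 p_norm p_sym i gp; lra.
Qed.

Lemma kinkZ k r s x (a : R) : 0 <= a -> kink k r s x -> kink k r s (a *: x).
Proof.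
move=> a0 [f [g [[fp fx] [gp gx] fr sg]]]; exists f, g.
by split=> //; split=> //; rewrite dotpZr ps.2// ?fx ?gx.
Qed.

(** Cut the sphere by the position j <> k and the sign of a coordinate that is
    largest among those other than the k-th.  The radial projection onto the
    corresponding face stays in the cone, hence is determined by its
    coordinates other than the j-th and the k-th: N-2 parameters. *)
Lemma kink_null k r s : r < s ->
  hausdorff N.-1 (unit_sphere p `&` kink k r s) = 0%E.
Proof.
move=> rs.
pose facet (je : 'I_N * bool) : set 'cV[R]_N := [set x | [/\ unit_sphere p x,
  kink k r s x, je.1 != k, 0 < (-1) ^+ je.2 * x je.1 0 &
  forall i, i != k -> `|x i 0| <= (-1) ^+ je.2 * x je.1 0]].
have cover x : (unit_sphere p `&` kink k r s) x -> exists je, facet je x.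
  move=> [x1 xk].
  (* otherwise comparing x with 0, a point of the cone, gives x_k = 0 as well *)
  have [j jk xj] : exists2 j, j != k & x j 0 != 0.
    apply: contrapT => h; have xi0 i : i != k -> x i 0 = 0.
      by move=> ik; apply/eqP/negPn/negP => xi; apply: h; exists i.
    have := kink_lipschitz rs xk (kinkZ (lexx 0) xk).
    rewrite big1 => [|i ik]; last by rewrite mxE xi0// mul0r subrr normr0.
    rewrite mulr0 scale0r mxE subr0 pmulr_rle0 ?subr_gt0// normr_le0.
    move=> /eqP xk0.
    have x0 : x = 0.
      apply/colP => i; rewrite mxE; have [->//|] := eqVneq i k.
      exact: xi0.
    move: x1; rewrite /unit_sphere/= x0 is_norm0// => /esym/eqP.
    by rewrite oner_eq0.
  pose m := [arg max_(i > j | i != k) `|x i 0|]%O.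
  have [mk mmax] : m != k /\ forall i, i != k -> `|x i 0| <= `|x m 0|.
    by rewrite /m; case: arg_maxP => // m' mk' h; split=> // i ik; exact: h.
  have mE : `|x m 0| = (-1) ^+ (x m 0 < 0)%R * x m 0.
    by rewrite -real_normrEsign ?num_real.
  exists (m, x m 0 < 0); split=> //=; rewrite -mE//.
  by rewrite (lt_le_trans _ (mmax _ jk))// normr_gt0.
apply: (@outer_measure_countable_null _ _
  (@hausdorff R N N.-1 : {outer_measure set 'cV[R]_N -> \bar R})
  _ facet _ cover).
move=> [j b] /=; set e : R := (-1) ^+ b.
have e1 : `|e| = 1 by rewrite normrX normrN1 expr1n.
have [jk|jk] := eqVneq j k.
  rewrite (_ : facet _ = set0) ?hausdorff0//.
  by rewrite -subset0 => x [_ _ /eqP].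
pose phi x (i : {i : 'I_N | (i != k) && (i != j)}) := x (val i) 0 / (e * x j 0).
pose C := N%:R + 2 / (s - r) * N%:R.
have C0 : 0 <= 2 / (s - r) * N%:R by rewrite mulr_ge0// divr_ge0// subr_ge0 ltW.
apply: (@hausdorff_lipschitz_null _ _ _ _ phi _ (2 * N%:R * C)).
- by rewrite !mulr_ge0// addr_ge0.
- move=> x i [_ _ _ x0 xm]; rewrite /phi normrM normfV (gtr0_norm x0).
  by rewrite ler_pdivrMr// mul1r xm//; case/andP: (valP i).
- move=> x y t [x1 xk _ x0 xm] [y1 yk _ y0 ym] t0 xyt.
  apply: (le_trans (facet_lipschitz e1 x1 y1 x0 y0)).
  rewrite -[leRHS]mulrA ler_wpM2l ?mulr_ge0//.
  have diff i : i != k -> `|x i 0 / (e * x j 0) - y i 0 / (e * y j 0)| <= t.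
    move=> ik; have [->|ij] := eqVneq i j.
      by rewrite !facet_axis// subrr normr0.
    have ikj : (i != k) && (i != j) by rewrite ik.
    exact: (xyt (exist _ i ikj)).
  have sumt : \sum_(i | i != k)
      `|x i 0 / (e * x j 0) - y i 0 / (e * y j 0)| <= N%:R * t.
    apply: (@le_trans _ _ (\sum_(i < N | i != k) t)); first exact: ler_sum.
    have -> : N%:R * t = \sum_(i < N) t.
      by rewrite sumr_const card_ord mulr_natl.
    by rewrite [leRHS](bigD1 k)//= lerDr.
  rewrite (bigD1 k)//= addrC mulrDl; apply: lerD => //.
  have x0' : 0 <= (e * x j 0)^-1 by rewrite invr_ge0 ltW.
  have y0' : 0 <= (e * y j 0)^-1 by rewrite invr_ge0 ltW.
  have := kink_lipschitz rs (kinkZ x0' xk) (kinkZ y0' yk).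
  have scaled (z : 'cV[R]_N) i :
      ((e * z j 0)^-1 *: z) i 0 = z i 0 / (e * z j 0).
    by rewrite mxE mulrC.
  rewrite !scaled; under eq_bigr do rewrite !scaled.
  rewrite mulrC -ler_pdivlMr ?subr_gt0// => /le_trans; apply.
  by rewrite mulrAC -[leRHS]mulrA ler_wpM2l// divr_ge0// subr_ge0 ltW.
- have := cardC1 k; rewrite (cardD1 j) inE jk card_ord add1n => <-.
  rewrite ltnS card_sig; apply/subset_leq_card/fintype.subsetP => i.
  by rewrite !inE andbC.
Qed.

Lemma nonsmooth_null :
  hausdorff N.-1 (unit_sphere p `\` smooth_points p) = 0%E.
Proof.
pose U (krs : 'I_N * rat * rat) : set 'cV[R]_N :=
  if ratr krs.1.2 < ratr krs.2 :> R
  then unit_sphere p `&` kink krs.1.1 (ratr krs.1.2) (ratr krs.2) else set0.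
apply: (@outer_measure_countable_null _ _
  (@hausdorff R N N.-1 : {outer_measure set 'cV[R]_N -> \bar R})
  _ U); last first.
  move=> [[k r] s]; rewrite /U/=; case: ifPn => [|_]; first exact: kink_null.
  exact: hausdorff0.
move=> x [x1 xD].
have [f [g [k [fx gx fg]]]] := nonsmooth_two p_norm p_sym x1 xD.
have [r] := rat_in_itvoo fg; rewrite in_itv/= => /andP[fr rg].
have [s] := rat_in_itvoo rg; rewrite in_itv/= => /andP[rs sg].
exists (k, r, s); rewrite /U/= rs; split=> //; exists f, g.
have sub h : norming p x h -> subgradient x h.
  by move=> /(normingP p_norm p_sym _ x1)[hp hx]; split=> //; rewrite hx.
by split; [exact: sub|exact: sub|exact: ltW..].
Qed.

(** The parameters u in [0, 1]^(N-1) are recovered from the radial projection of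
    (1, u) as quotients by its first coordinate, which is at least 1/N. *)
Lemma hausdorff_sphere_gt0 : (0 < hausdorff N.-1 (unit_sphere p))%E.
Proof.
pose y (u : nat -> R) : 'cV[R]_N :=
  \col_i (if i == 0%N :> nat then 1 else u i.-1).
pose x u := (p (y u))^-1 *: y u.
pose i0 : 'I_N := Ordinal N_gt0.
have Ngt0 : 0 < N%:R :> R by rewrite ltr0n.
have py1 u : 1 <= p (y u).
  by have := coord_le_norm p_norm p_sym (y u) i0; rewrite mxE/= normr1.
have py0 u : 0 < p (y u) by exact: lt_le_trans (py1 u).
have pyN u : (forall i, 0 <= u i <= 1) -> p (y u) <= N%:R.
  move=> u01; apply: (le_trans (norm_le_sum p_norm p_sym _)).
  apply: (@le_trans _ _ (\sum_(i < N) 1)); last by rewrite sumr_const card_ord.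
  apply: ler_sum => i _; rewrite mxE; case: ifP => _; first by rewrite normr1.
  by have /andP[? ?] := u01 i.-1; rewrite ger0_norm.
apply: lt_le_trans (@hausdorff_lower_bound _ _ _ _ x (2 * N%:R) _ _ _).
- by rewrite lte_fin invr_gt0 exprn_gt0// !mulr_gt0.
- by rewrite mulr_gt0.
- move=> u _; rewrite /unit_sphere/= /x pZ gtr0_norm ?invr_gt0//.
  by rewrite mulVf ?gt_eqF.
- move=> u v i u01 v01 iN.
  have iN' : (i.+1 < N)%N by rewrite -ltn_predRL.
  pose i1 : 'I_N := Ordinal iN'.
  have := ler_coord_euclidean (x u - x v) i0.
  have := ler_coord_euclidean (x u - x v) i1.
  rewrite !mxE/= !mulr1.
  set d := euclidean_norm _; set a := p (y u); set b := p (y v) => h1 h0.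
  have -> : u i - v i = a * ((a^-1 * u i - b^-1 * v i) - v i * (a^-1 - b^-1)).
    by field; rewrite !gt_eqF ?py0.
  rewrite normrM gtr0_norm ?py0// mulrC [2 * _]mulrC -mulrA mulrC.
  apply: (@le_trans _ _ (a * (2 * d))); last first.
    by rewrite ler_wpM2r ?pyN// mulr_ge0// euclidean_norm_ge0.
  rewrite ler_pM2l ?py0//; apply: (le_trans (ler_normB _ _)).
  rewrite mulr_natl mulr2n; apply: lerD => //; rewrite normrM.
  apply: le_trans h0; rewrite ler_piMl//.
  by have /andP[? ?] := v01 i; rewrite ger0_norm.
Qed.

End Sphere.

(** * The surface measure *)

Section SurfaceMeasure.
Variables (R : realType) (N : nat) (p : 'cV[R]_N -> R).
Hypothesis N_gt0 : (0 < N)%N.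
Hypothesis p_norm : is_norm p.
Hypothesis p_sym : one_symmetric p (@canonical_basis R N).
Implicit Types (x y f g v : 'cV[R]_N) (A : set 'cV[R]_N).
Local Notation X := (caratheodory_type (surface_outer p)).
Local Notation mu := (surface_measure p).
Local Notation D := (smooth_points p : set X).
Local Notation S := (unit_sphere p : set X).

Lemma surface_outer_sphere : surface_outer p (unit_sphere p) = 1%E.
Proof.
rewrite /surface_outer setIid.
have fin : hausdorff N.-1 (unit_sphere p) \is a fin_num.
  by rewrite ge0_fin_numE ?hausdorff_ge0// hausdorff_sphere_lt_pinfty.
rewrite -[X in (_ * X)%E](fineK fin) -EFinM mulVf// gt_eqF//.
by rewrite -lte_fin fineK// hausdorff_sphere_gt0.
Qed.

Lemma surface_outer_null A :
  hausdorff N.-1 (A `&` unit_sphere p) = 0%E -> surface_outer p A = 0%E.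
Proof. by rewrite /surface_outer => ->; rewrite mule0. Qed.

Lemma surface_null_measurable (A : set X) :
  surface_outer p A = 0%E -> measurable A.
Proof.
move=> A0; apply: (le_caratheodory_measurable (mu := surface_outer p)) => Y /=.
rewrite [X in (X + _)%E](_ : _ = 0%E) ?add0e.
  by apply: le_surface_outer => x [].
apply/eqP; rewrite eq_le surface_outer_ge0 andbT -A0.
by apply: le_surface_outer => x [].
Qed.

Lemma surface_null_off_sphere : mu (~` S) = 0%E.
Proof. by apply: surface_outer_null; rewrite setICl hausdorff0. Qed.

Lemma surface_null_not_smooth : mu (~` D) = 0%E.
Proof.
apply: surface_outer_null; rewrite setIC -setDE.
exact: nonsmooth_null.
Qed.

Lemma surface_null_nonsmooth : mu (S `\` D) = 0%E.
Proof.
apply/eqP; rewrite eq_le measure_ge0 andbT -surface_null_not_smooth.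
by apply: le_surface_outer => x [].
Qed.

Lemma measurable_sphere : measurable S.
Proof.
rewrite -(setCK S); apply: measurableC.
exact: surface_null_measurable surface_null_off_sphere.
Qed.

Lemma measurable_smooth : measurable D.
Proof.
rewrite -(setCK D); apply: measurableC.
exact: surface_null_measurable surface_null_not_smooth.
Qed.

Lemma surface_measure_setT : mu setT = 1%E.
Proof.
rewrite -surface_outer_sphere /surface_measure/= /surface_outer setTI.
by rewrite setIid.
Qed.

Lemma surface_measure_smooth : mu D = 1%E.
Proof.
rewrite -surface_measure_setT -(setvU D) setUC measureU0//.
- exact: measurable_smooth.
- by apply: measurableC; exact: measurable_smooth.
- exact: surface_null_not_smooth.
Qed.

Lemma lipschitz_measurable (phi : 'cV[R]_N -> R) (L : R) :
  (forall x y, `|phi x - phi y| <= L * euclidean_norm (x - y)) ->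
  measurable_fun setT (phi : X -> R).
Proof.
move=> lip; have L1 : 0 < `|L| + 1 by rewrite ltr_wpDl.
have lip1 x y : `|phi x - phi y| <= (`|L| + 1) * euclidean_norm (x - y).
  apply: (le_trans (lip x y)); apply: ler_wpM2r.
    exact: euclidean_norm_ge0.
  by rewrite (le_trans (ler_norm _))// lerDl.
have le_meas c : measurable ([set x | phi x <= c] : set X).
  move=> Y; rewrite /surface_outer.
  rewrite -ge0_muleDr ?hausdorff_ge0//; congr (_ * _)%E.
  rewrite (hausdorff_caratheodory _ L1 lip1 c (Y `&` unit_sphere p)) /=.
  by rewrite setIAC [in X in (_ + X)%E = _]setIAC.
apply: (measurability _ (RGenOInfty.measurableE R)) => //.
move=> _ [_ [c ->] <-]; rewrite setTI.
rewrite (_ : _ @^-1` _ = ~` [set x | phi x <= c]).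
  exact/measurableC/le_meas.
apply/seteqP; split=> x /=; rewrite in_itv/= andbT => h.
  by rewrite leNgt h.
by rewrite ltNge; apply/negP.
Qed.

Lemma measurable_coord j : measurable_fun setT ((fun x => x j 0) : X -> R).
Proof.
apply: (@lipschitz_measurable _ 1) => x y; rewrite mul1r.
by have := ler_coord_euclidean (x - y) j; rewrite !mxE.
Qed.

(** x*_i is the limit of the quotients p (e_i + n x) - n p x. *)
Lemma measurable_star i : measurable_fun D ((fun x => star p x i 0) : X -> R).
Proof.
pose q (t : R) (x : 'cV[R]_N) := p (canonical_basis R i + t *: x) - t * p x.
have mq t : measurable_fun setT (q t : X -> R).
  apply: measurable_funB.
    apply: (@lipschitz_measurable _ (N%:R * `|t|)) => x y.
    apply: (le_trans (norm_lipschitz p_norm p_sym _ _)).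
    by rewrite opprD addrACA subrr add0r -scalerBr euclidean_normZ mulrA.
  apply: measurable_funM; first exact: measurable_cst.
  by apply: (@lipschitz_measurable _ N%:R); exact: norm_lipschitz.
apply: (@measurable_fun_cvg _ _ _ D (fun n => q n%:R)).
  by move=> n; apply: measurable_funTS.
move=> x xD; apply/cvgrPdist_lt => e e0.
have ps := norm_sublinear p_norm.
have [|t t0 qt] := dirderiv_lt ps (w := x) (v := canonical_basis R i)
  (b := star p x i 0 + e).
  by rewrite -(star_dirderiv p_norm p_sym _ xD) dotp_basis ltrDl.
exists (Num.truncn t).+1 => // n /= tn.
have ge : star p x i 0 <= q n%:R x.
  rewrite -dotp_basis (star_dirderiv p_norm p_sym _ xD); exact: dirderiv_le.
have le : q n%:R x <= q t x.
  apply: dirquot_anti => //; rewrite t0/= ltW// (lt_le_trans (truncnS_gt t))//.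
  by rewrite ler_nat.
by rewrite distrC ger0_norm ?subr_ge0// ltrBlDl; exact: le_lt_trans le qt.
Qed.

(** * Means of the products x_j x*_i *)

Lemma surface_outer_signed_perm eps s A : signs eps ->
  surface_outer p (signed_perm eps s @^-1` A) = surface_outer p A.
Proof.
move=> e1; rewrite /surface_outer; congr (_ * _)%E.
have -> : signed_perm eps s @^-1` A `&` unit_sphere p =
    signed_perm eps s @^-1` (A `&` unit_sphere p).
  apply/seteqP; split=> x [Ax x1]; split=> //; move: x1;
    by rewrite /unit_sphere/= one_symmetric_signed_perm.
apply: (hausdorff_preimage _ _ (signed_permK s e1) (signed_permVK s e1)) => x y.
by rewrite -signed_permB euclidean_signed_perm.
Qed.

Lemma measurable_signed_perm eps s : signs eps ->
  measurable_fun setT (signed_perm eps s : X -> X).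
Proof.
move=> e1 _ A mA; rewrite setTI.
suff cara : caratheodory_measurable (surface_outer p)
    (signed_perm eps s @^-1` A).
  exact: cara.
have {}mA : caratheodory_measurable (surface_outer p) A by exact: mA.
move=> Y; have YE : Y = signed_perm eps s @^-1` (signed_perm_inv eps s @^-1` Y).
  by apply/seteqP; split=> x /=; rewrite signed_permK.
rewrite YE; move: (signed_perm_inv eps s @^-1` Y) => Z.
rewrite preimage_setC -2!preimage_setI.
by rewrite 3!(surface_outer_signed_perm _ _ e1); exact: mA.
Qed.

(** Extended by 0 outside the smooth points, so that changes of variables can be
    made on the whole space. *)
Definition moment (i j : 'I_N) : X -> R :=
  (fun x => x j 0 * star p x i 0) \_ D.

Lemma moment_smooth i j x : smooth_points p x ->
  moment i j x = x j 0 * star p x i 0.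
Proof. by move=> xD; rewrite /moment patchE mem_set. Qed.

Lemma moment_nonsmooth i j x : ~ smooth_points p x -> moment i j x = 0.
Proof. by move=> xD; rewrite /moment patchE memNset. Qed.

Lemma moment_integrable i j : mu.-integrable setT (EFin \o moment i j).
Proof.
apply: (@measurable_bounded_integrable _ _ _ mu (moment i j) setT measurableT).
- by rewrite surface_measure_setT ltry.
- apply/(measurable_restrictT _ measurable_smooth).
  apply: measurable_funM; last exact: measurable_star.
  exact/measurable_funTS/measurable_coord.
- exists 1; split=> // M M1 x _; apply: le_trans (ltW M1).
  have [xD|xD] := pselect (smooth_points p x); last first.
    by rewrite moment_nonsmooth// normr0.
  rewrite moment_smooth// normrM mulr_ile1//.
    by rewrite -xD.1; exact: coord_le_norm.
  have [fp _] := (normingP p_norm p_sym _ xD.1).1 (smooth_star xD).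
  exact: (dominated_coord_le1 p_norm p_sym i fp).
Qed.

Lemma moment_signed_perm eps (s : {perm 'I_N}) i j x : signs eps ->
  moment i j (signed_perm eps s x) = eps i * eps j * moment (s i) (s j) x.
Proof.
move=> e1; have [xD|xD] := pselect (smooth_points p x).
  rewrite !moment_smooth ?star_signed_perm//; last exact: smooth_signed_perm.
  by rewrite !mxE; ring.
rewrite !moment_nonsmooth ?mulr0// => TxD; apply: xD.
rewrite -(signed_permK s e1 x).
by apply: smooth_signed_perm TxD => //; exact: signs_inv.
Qed.

Definition mean_moment i j : R := fine (\int[mu]_x (moment i j x)%:E)%E.

Lemma integral_moment i j :
  (\int[mu]_x (moment i j x)%:E = (mean_moment i j)%:E)%E.
Proof.
rewrite /mean_moment fineK//.
exact: (integrable_fin_num measurableT (moment_integrable i j)).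
Qed.

(** Change of variables by the signed permutation, which preserves the
    measure. *)
Lemma mean_moment_signed_perm eps (s : {perm 'I_N}) i j : signs eps ->
  mean_moment i j = eps i * eps j * mean_moment (s i) (s j).
Proof.
move=> e1; have mT := measurable_signed_perm s e1.
apply/EFin_inj; rewrite EFinM -!integral_moment -integralZl//; last first.
  exact: moment_integrable.
have momentT : (EFin \o moment i j) \o signed_perm eps s =
    fun x => ((eps i * eps j)%:E * (moment (s i) (s j) x)%:E)%E.
  by apply/funext => x /=; rewrite moment_signed_perm.
have mf : measurable_fun setT (EFin \o moment i j).
  exact: measurable_int (moment_integrable i j).
have intf : mu.-integrable (signed_perm eps s @^-1` setT)
    ((EFin \o moment i j) \o signed_perm eps s).
  rewrite momentT preimage_setT.
  exact: (integrableZl measurableT _ (moment_integrable _ _)).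
have := integral_pushforward mT mf intf measurableT.
rewrite momentT preimage_setT => <-.
apply: eq_measure_integral => A mA _ /=.
by rewrite /pushforward; apply/esym/surface_outer_signed_perm.
Qed.

Lemma mean_moment_offdiag i j : i != j -> mean_moment i j = 0.
Proof.
move=> ij; pose eps k : R := if k == i then -1 else 1.
have e1 : signs eps by move=> k; rewrite /eps; case: ifP; [left|right].
have := mean_moment_signed_perm 1 i j e1.
by rewrite /eps eqxx eq_sym (negbTE ij) !perm1; lra.
Qed.

Lemma mean_moment_diag i j : mean_moment i i = mean_moment j j.
Proof.
have e1 : signs (fun _ : 'I_N => 1 : R) by move=> k; right.
by rewrite (mean_moment_signed_perm (tperm i j) i i e1) !mul1r tpermL.
Qed.

(** At a smooth point the diagonal products add up to <x*, x> = 1. *)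
Lemma mean_moment_trace : \sum_i mean_moment i i = 1.
Proof.
apply/EFin_inj; rewrite -sumEFin; under eq_bigr do rewrite -integral_moment.
rewrite -integral_sum//; last by move=> i; exact: moment_integrable.
rewrite -surface_measure_smooth -[D in RHS]setIT -integral_indic//; last first.
  exact: measurable_smooth.
apply: eq_integral => x _; rewrite sumEFin indicE; congr EFin.
have [xD|xD] := pselect (smooth_points p x); last first.
  by rewrite memNset// big1// => i _; rewrite moment_nonsmooth.
rewrite mem_set//; under eq_bigr do rewrite moment_smooth// mulrC.
have := smooth_star xD.
by move=> /(normingP p_norm p_sym _ xD.1)[_ <-].
Qed.

Lemma mean_moment_diagE i : N%:R * mean_moment i i = 1.
Proof.
have := mean_moment_trace; rewrite (eq_bigr (fun=> mean_moment i i)).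
  by rewrite sumr_const card_ord mulr_natl.
by move=> j _; exact: mean_moment_diag.
Qed.

Lemma dotp_mulmx_moment (A : 'M[R]_N) x : smooth_points p x ->
  dotp (A *m x) (star p x) = \sum_i \sum_j A i j * moment i j x.
Proof.
move=> xD; apply: eq_bigr => i _; rewrite mxE mulr_suml; apply: eq_bigr => j _.
by rewrite moment_smooth// mulrA.
Qed.

Lemma trace_formula (A : 'M[R]_N) :
  mu.-integrable D (fun x => (dotp (A *m (x : 'cV[R]_N)) (star p x))%:E) /\
  (\tr A)%:E = (N%:R%:E * \int[mu]_(x in D)
    (dotp (A *m (x : 'cV[R]_N)) (star p x))%:E)%E.
Proof.
pose h (x : X) : \bar R := (\sum_i \sum_j (A i j)%:E * (moment i j x)%:E)%E.
have intij i j : mu.-integrable setT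
    (fun x => (A i j)%:E * (moment i j x)%:E)%E.
  exact: (integrableZl measurableT _ (moment_integrable _ _)).
have inti i : mu.-integrable setT
    (fun x => \sum_j (A i j)%:E * (moment i j x)%:E)%E.
  by apply: integrable_sum => // j _; exact: intij.
have inth : mu.-integrable setT h.
  by apply: integrable_sum => // i _; exact: inti.
have hE (x : X) : D x -> (dotp (A *m (x : 'cV[R]_N)) (star p x))%:E = h x.
  move=> xD; rewrite dotp_mulmx_moment// -sumEFin; apply: eq_bigr => i _.
  by rewrite -sumEFin; apply: eq_bigr => j _; rewrite EFinM.
have hD : mu.-integrable D h.
  by apply: (integrableS measurableT measurable_smooth _ inth).
split.
  apply: eq_integrable hD => //; first exact: measurable_smooth.
  by move=> x; rewrite inE => /hE ->.
rewrite (eq_integral h); last by move=> x; rewrite inE => /hE.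
have -> : (\int[mu]_(x in D) h x = \int[mu]_x h x)%E.
  rewrite [RHS](@negligible_integral _ _ _ mu _ (~` D))//.
  - by rewrite setDE setCK setTI.
  - by apply: measurableC; exact: measurable_smooth.
  - exact: surface_null_not_smooth.
have entry i j : (\int[mu]_x ((A i j)%:E * (moment i j x)%:E) =
    (A i j * mean_moment i j)%:E)%E.
  rewrite EFinM -integral_moment.
  exact: (integralZl measurableT (moment_integrable i j)).
have row i : (\int[mu]_x (\sum_j (A i j)%:E * (moment i j x)%:E) =
    (A i i * mean_moment i i)%:E)%E.
  rewrite integral_sum// (bigD1 i)//= big1 ?adde0 => [|j ji].
    exact: entry.
  by rewrite entry mean_moment_offdiag ?mulr0// eq_sym.
rewrite /h integral_sum//; under eq_bigr do rewrite row.
rewrite sumEFin -EFinM mulr_sumr; congr EFin; apply: eq_bigr => i _.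
by rewrite mulrCA mean_moment_diagE mulr1.
Qed.

End SurfaceMeasure.

Theorem mainTheorem1 (R : realType) (N : nat) (p : 'cV[R]_N -> R)
    (N_gt0 : (0 < N)%N)
    (p_norm : is_norm p)
    (p_sym : one_symmetric p (@canonical_basis R N)) :
  (surface_measure p (unit_sphere p `\` smooth_points p) = 0%E /\
   {within smooth_points p, continuous (star p)}) /\
  (forall A : 'M[R]_N,
     ((surface_measure p).-integrable (smooth_points p)
        (fun x => (dotp (A *m (x : 'cV[R]_N)) (star p x))%:E) /\
      (\tr A)%:E =
        (N%:R%:E * \int[surface_measure p]_(x in smooth_points p)
                     (dotp (A *m (x : 'cV[R]_N)) (star p x))%:E)%E) /\
     (forall g : 'cV[R]_N -> 'cV[R]_N,
        (forall x, smooth_points p x -> g x = star p x) ->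
        (forall x, unit_sphere p x -> dual_norm p (g x) = 1) ->
        (forall i, measurable_fun
           (unit_sphere p : set (caratheodory_type (surface_outer p)))
           (fun x : caratheodory_type (surface_outer p) => g x i 0)) ->
        (surface_measure p).-integrable (unit_sphere p)
          (fun x => (dotp (A *m (x : 'cV[R]_N)) (g x))%:E) /\
        (\tr A)%:E =
          (N%:R%:E * \int[surface_measure p]_(x in unit_sphere p)
                       (dotp (A *m (x : 'cV[R]_N)) (g x))%:E)%E)).
Proof.
split; first by split; [exact: surface_null_nonsmooth|exact: star_continuous].
move=> A; have [intD trD] := trace_formula N_gt0 p_norm p_sym A.
split=> // g gD _ mg.
have mS := measurable_sphere p.
have mD := measurable_smooth p_norm p_sym.
have mSD := measurableD mS mD.
have nullSD := surface_null_nonsmooth p_norm p_sym.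
have SDD :
    unit_sphere p `\` (unit_sphere p `\` smooth_points p) = smooth_points p.
  rewrite setDD; apply/seteqP; split=> [x []//|x xD]; split=> //.
  exact: xD.1.
have mG : measurable_fun
    (unit_sphere p : set (caratheodory_type (surface_outer p)))
    (fun x : caratheodory_type (surface_outer p) =>
      (dotp (A *m (x : 'cV[R]_N)) (g x))%:E).
  apply/measurable_EFinP; apply: measurable_sum => i.
  apply: measurable_funM; last exact: mg.
  apply: measurable_funTS.
  under eq_fun do rewrite mxE.
  apply: measurable_sum => j.
  apply: measurable_funM; first exact: measurable_cst.
  exact: measurable_coord.
have gE : {in smooth_points p, (fun x => (dotp (A *m x) (g x))%:E) =1
    (fun x => (dotp (A *m x) (star p x))%:E)}.
  by move=> x; rewrite inE => /gD ->.
have intS : (surface_measure p).-integrable (unit_sphere p)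
    (fun x => (dotp (A *m (x : 'cV[R]_N)) (g x))%:E).
  apply/(negligible_integrable mSD mS mG nullSD); rewrite SDD.
  by apply: (eq_integrable mD _ _ _ intD) => x /gE ->.
split=> //; rewrite (negligible_integral mSD mS intS nullSD) SDD trD.
by congr (_ * _)%E; apply: eq_integral => x /gE.
Qed.
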